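(* Let $z'=(\{z'_\ell\},\{z'_r\})$ and $z''=(\{z''_\ell\},\{z''_r\})$ be a bi-free pair of two-faced families (each face consisting of a single element) in a non-commutative probability space $(\mathcal A,\varphi)$, and let $z=(\{z'_\ell z''_\ell\},\{z''_r z'_r\})$. Then $$\kappa_\chi(z)=\sum_{\pi\in BNC(\chi)}\kappa_\pi(z')\,\kappa_{K_{BNC}(\pi)}(z'')$$ for all $n\ge1$ and all $\chi:\{1,\dots,n\}\to\{\ell,r\}$.
   Context: A non-commutative probability space $(\mathcal{A},\varphi)$ is a unital complex algebra with a linear functional $\varphi$, $\varphi(1)=1$. A two-faced family $(\{w_\ell\},\{w_r\})$ here consists of one left element $w_\ell$ and one right element $w_r$ of $\mathcal A$; for $z$ the left element is $z_\ell=z'_\ell z''_\ell$ and the right element is $z_r=z''_rz'_r$. Free products. A vector space with specified state-vector $(\mathcal X,p,\xi)$ is a complex vector space $\mathcal X=\mathbb C\xi\oplus\mathring{\mathcal X}$, $\xi\neq0$, with $p$ the projection onto $\mathbb C\xi$ with kernel $\mathring{\mathcal X}$. $\mathcal L(\mathcal X)$ is the algebra of all linear maps on $\mathcal X$, with state $\varphi$ given by $p(T\xi)=\varphi(T)\xi$. The free product $(\mathcal X,p,\xi)=(\mathcal X',p',\xi')*(\mathcal X'',p'',\xi'')$ is $\mathcal X=\mathbb C\xi\oplus\bigoplus_{m\ge1}\bigoplus_{\delta_1\ne\delta_2\neq\cdots\ne\delta_m}\mathring{\mathcal X}^{\delta_1}\otimes\cdots\otimes\mathring{\mathcal X}^{\delta_m}$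 ($\delta_t\in\{',''\}$, consecutive ones distinct), with $p$ the projection onto $\mathbb C\xi$ killing the other summands. For $\delta\in\{',''\}$, let $\mathcal X(\ell,\delta)$ (resp. $\mathcal X(r,\delta)$) be the sum of $\mathbb C\xi$ and those tensor summands with $\delta_1\ne\delta$ (resp. $\delta_m\neq\delta$). Natural identifications (with $\xi^\delta\otimes x\mapsto x$, $x\otimes\xi^\delta\mapsto x$, $y\otimes \xi\mapsto y$, $\xi\otimes y\mapsto y$ for $y\in\mathring{\mathcal X}^\delta$, and concatenation otherwise) give isomorphisms $V_\delta:\mathcal X^\delta\otimes\mathcal X(\ell,\delta)\to\mathcal X$ and $W_\delta:\mathcal X(r,\delta)\otimes\mathcal X^\delta\to\mathcal X$. For $T\in\mathcal L(\mathcal X^\delta)$ put $\lambda^\delta(T)=V_\delta(T\otimes 1)V_\delta^{-1}$ and $\rho^\delta(T)=W_\delta(1\otimes T)W_\delta^{-1}$ in $\mathcal L(\mathcal X)$. Bi-freeness. $z',z''$ are bi-free if there exist such a free product and unital homomorphisms $l^\delta:\mathbb C\langle z_\ell^\delta\rangle\to\mathcal L(\mathcal X^\delta)$, $r^\delta:\mathbb C\langle z_r^\delta\rangle\to\mathcal L(\mathcal X^\delta)$, $\delta\in\{',''\}$ (on polynomial algebras in formal variables), such that the families $(\lambda^\delta(l^\delta(z_\ell^\delta)),\rho^\delta(r^\delta(z_r^\delta)))$, $\delta\in\{',''\}$, have in $(\mathcal L(\mathcal X),\varphi)$ the same joint distribution (all joint mixed moments of the two families together) as $z'$ and $z''$ in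 $(\mathcal A,\varphi)$. Bi-non-crossing partitions. For $\chi:\{1,\dots,n\}\to\{\ell,r\}$ write $\chi^{-1}(\ell)=\{i_1<\cdots<i_p\}$, $\chi^{-1}(r)=\{j_1<\cdots<j_{n-p}\}$ and let $s_\chi\in S_n$ be $s_\chi(k)=i_k$ for $k\le p$, $s_\chi(k)=j_{n+1-k}$ for $k>p$. $S_n$ acts on partitions by acting on blocks. $NC(n)$ is the set of non-crossing partitions of $\{1,\dots,n\}$ and $BNC(\chi)=\{\pi: s_\chi^{-1}\cdot\pi\in NC(n)\}$. Kreweras complement. For $\sigma\in NC(n)$, $K_{NC}(\sigma)\in NC(n)$ is the usual Kreweras complement: the largest partition $\tau$ (in refinement order) such that $\sigma\cup\tau$ is non-crossing on $1<\bar1<2<\bar2<\cdots<n<\bar n$, with $\sigma$ placed on $1,\dots,n$ and $\tau$ on $\bar1,\dots,\bar n$. For $\pi\in BNC(\chi)$, $K_{BNC}(\pi)=s_\chi\cdot K_{NC}(s_\chi^{-1}\cdot\pi)\in BNC(\chi)$. Cumulants. The functionals $\kappa_\chi:\mathcal A^n\to\mathbb C$ are the multilinear functionals uniquely determined by $\varphi(a_1\cdots a_n)=\sum_{\pi\in BNC(\chi)}\prod_{V\in\pi}\kappa_{\chi|_V}((a_1,\dots,a_n)|V)$ for all $n\geq 1$, all $\chi:\{1,\dots,n\}\to\{\ell,r\}$ and all $a_1,\dots,a_n\in\mathcal A$, where for $V=\{v_1<\cdots<v_m\}$, $\chi|_V(t)=\chi(v_t)$ and $(a_1,\dots,a_n)|V=(a_{v_1},\dots,a_{v_m})$.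 For a two-faced family $w=(\{w_\ell\},\{w_r\})$ and $\pi\in BNC(\chi)$: $\kappa_\chi(w)=\kappa_\chi(w_{\chi(1)},\dots,w_{\chi(n)})$ and $\kappa_\pi(w)=\prod_{V\in\pi}\kappa_{\chi|_V}((w_{\chi(1)},\dots,w_{\chi(n)})|V)$. *)

(* Defs.v *)
From HB Require Import structures.
From mathcomp Require Import all_boot all_algebra all_fingroup.
From mathcomp Require Import boolp.
From mathcomp Require Import generic_quotient freeg.
Set Implicit Arguments.
Unset Strict Implicit.
Unset Printing Implicit Defensive.
Import GRing.Theory.
Local Open Scope ring_scope.
Local Open Scope quotient_scope.

Section Span.
Context (K : fieldType) (V : lmodType K) (S : V -> Prop).

Inductive spanned : V -> Prop :=
| Spanned0 : spanned 0
| SpannedD a u v : S u -> spanned v -> spanned (a *: u + v).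

Lemma spannedD u v : spanned u -> spanned v -> spanned (u + v).
Proof.
elim=> [|a u1 u2 Su _ IH] sv; first by rewrite add0r.
by rewrite -addrA; apply: SpannedD => //; apply: IH.
Qed.

Lemma spannedZ a u : spanned u -> spanned (a *: u).
Proof.
elim=> [|b u1 u2 Su _ IH]; first by rewrite scaler0; left.
by rewrite scalerDr scalerA; right.
Qed.

Definition span_pred : {pred V} := fun v => `[< spanned v >].

Lemma span_pred_submod : submod_closed span_pred.
Proof.
split=> [|a u v]; first by apply/asboolP; left.
move=> /asboolP su /asboolP sv; apply/asboolP.
by apply: spannedD => //; apply: spannedZ.
Qed.
HB.instance Definition _ := GRing.isSubmodClosed.Build K V span_pred span_pred_submod.

Lemma mem_span u : S u -> u \in span_pred.
Proof.
by move=> Su; apply/asboolP; rewrite -[u]scale1r -[1 *: u]addr0; right=> //; left.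
Qed.

End Span.

Section FreeLift.
Context (K : fieldType) (I : choiceType) (W : lmodType K) (f : I -> W).

Lemma fglift_linear : linear (fglift f : {freeg I / K} -> W).
Proof.
have addf : {morph (fglift f : {freeg I / K} -> W) : x y / x + y}.
  move=> x y; have add := @lift_is_additive K I W f.
  have l0 : fglift f (0 : {freeg I / K}) = 0 by rewrite -(subrr 0) add subrr.
  by rewrite -{1}[y]opprK add -[- y]sub0r add l0 sub0r opprK.
have scalef a (x : {freeg I / K}) : fglift f (a *: x) = a *: fglift f x.
  have l0 : fglift f (0 : {freeg I / K}) = 0.
    by apply: (addIr (fglift f 0)); rewrite -addf !add0r.
  rewrite -[x in RHS]freeg_sumE !(big_morph _ addf l0) scaler_sumr.
  by apply: eq_bigr => i _; rewrite !liftU scalerA.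
by move=> a x y; rewrite addf scalef.
Qed.
HB.instance Definition _ :=
  GRing.isLinear.Build K {freeg I / K} W *:%R (fglift f) fglift_linear.

Lemma fgliftE i : fglift f (<< i >> : {freeg I / K}) = f i.
Proof. by rewrite liftU scale1r. Qed.

End FreeLift.

Section Presented.
Context (K : fieldType) (I : choiceType) (rel : {freeg I / K} -> Prop).

(* The K-vector space with generators I and relations rel. *)
Definition presented := Quotient.quot (span_pred rel).
HB.instance Definition _ := GRing.Zmodule.on presented.
HB.instance Definition _ := ZmodQuotient.on presented.

Local Notation Q := presented.
Implicit Types x y : {freeg I / K}.

Let piD x y : \pi_Q (x + y) = \pi_Q x + \pi_Q y.
Proof. exact: raddfD. Qed.

Let pi_eq x y : x - y \in span_pred rel -> \pi_Q x = \pi_Q y.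
Proof. by rewrite Quotient.idealrBE => /eqP. Qed.

Let eq_pi x y : \pi_Q x = \pi_Q y -> x - y \in span_pred rel.
Proof. by move=> e; rewrite Quotient.idealrBE; apply/eqP. Qed.

Definition presented_scale (a : K) (q : Q) : Q := \pi_Q (a *: repr q).

Lemma presented_scale_pi a x : presented_scale a (\pi_Q x) = \pi_Q (a *: x).
Proof.
apply: pi_eq; rewrite -scalerBr.
by rewrite rpredZ // eq_pi ?reprK.
Qed.

Lemma presented_piP (q : Q) : exists x, q = \pi_Q x.
Proof. by exists (repr q); rewrite reprK. Qed.

Lemma presented_scaleA a b q :
  presented_scale a (presented_scale b q) = presented_scale (a * b) q.
Proof.
have [x ->] := presented_piP q.
by rewrite presented_scale_pi [LHS]presented_scale_pi scalerA presented_scale_pi.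
Qed.
Lemma presented_scale1 : left_id 1 presented_scale.
Proof.
by move=> q; have [x ->] := presented_piP q; rewrite presented_scale_pi scale1r.
Qed.
Lemma presented_scaleDr : right_distributive presented_scale +%R.
Proof.
move=> a p q; have [x ->] := presented_piP p; have [y ->] := presented_piP q.
by rewrite -piD presented_scale_pi scalerDr piD -!presented_scale_pi.
Qed.
Lemma presented_scaleDl q : {morph presented_scale^~ q : a b / a + b}.
Proof.
move=> a b; have [x ->] := presented_piP q.
by rewrite presented_scale_pi scalerDl piD -!presented_scale_pi.
Qed.
HB.instance Definition _ := GRing.Zmodule_isLmodule.Build K presented
  presented_scaleA presented_scale1 presented_scaleDr presented_scaleDl.

Definition pgen (i : I) : presented := \pi_Q (<< i >> : {freeg I / K}).

Lemma presented_rel x : rel x -> \pi_Q x = 0.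
Proof.
move=> rx; rewrite -(raddf0 (\pi_Q)); apply: pi_eq.
by rewrite subr0 mem_span.
Qed.

Lemma pi_presented_linear : linear (\pi_Q : {freeg I / K} -> Q).
Proof. by move=> a x y; rewrite piD -presented_scale_pi. Qed.
HB.instance Definition _ :=
  GRing.isLinear.Build K {freeg I / K} Q *:%R \pi_Q pi_presented_linear.

Lemma pi_presentedE x : \pi_Q x = fglift pgen x.
Proof.
rewrite -[x]freeg_sumE; elim: (dom x) => [|i s IH].
  by rewrite big_nil !linear0.
rewrite big_cons [LHS]linearD [RHS]linearD /= -IH liftU /pgen -linearZ /=.
congr (\pi _ + _); apply/eqP/freeg_eqP => j; rewrite coeffZ !coeffU.
by rewrite mulrA mulr1.
Qed.

Lemma presented_ext (W : lmodType K) (f g : {linear Q -> W}) :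
  (forall i, f (pgen i) = g (pgen i)) -> f =1 g.
Proof.
move=> fg q; have [x ->] := presented_piP q; rewrite !pi_presentedE.
rewrite -[x]freeg_sumE !linear_sum /=.
by apply: eq_bigr => i _; rewrite liftU !linearZ /= fg.
Qed.

Section Lift.
Context (W : lmodType K) (f : I -> W) (Hf : forall x, rel x -> fglift f x = 0).

Definition presented_lift_fun of (forall x, rel x -> fglift f x = 0) :=
  fun q : presented => fglift f (repr q).

Let lift_span x : x \in span_pred rel -> fglift f x = 0.
Proof.
move=> /asboolP; elim=> [|a u v ru _ IH]; first by rewrite linear0.
by rewrite linearP /= Hf // scaler0 add0r.
Qed.

Let lift_pi x : presented_lift_fun Hf (\pi_Q x) = fglift f x.
Proof.
apply/eqP; rewrite -subr_eq0 -linearB /= lift_span //.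
by apply: eq_pi; exact: reprK.
Qed.

Lemma presented_lift_linear : linear (presented_lift_fun Hf).
Proof.
move=> a p q; have [x ->] := presented_piP p; have [y ->] := presented_piP q.
by rewrite -linearP !lift_pi linearP.
Qed.
HB.instance Definition _ := GRing.isLinear.Build K presented W *:%R
  (presented_lift_fun Hf) presented_lift_linear.

Definition presented_lift : {linear presented -> W} := presented_lift_fun Hf.

Lemma presented_liftE i : presented_lift (pgen i) = f i.
Proof. by rewrite [LHS]lift_pi fgliftE. Qed.
End Lift.

End Presented.

Section Tensor.
Context (K : fieldType) (U V : lmodType K).

Inductive tensor_rel : {freeg (U * V) / K} -> Prop :=
| TensorRelL a u u' v :
    tensor_rel (<< (a *: u + u', v) >> - a *: << (u, v) >> - << (u', v) >>)
| TensorRelR a u v v' :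
    tensor_rel (<< (u, a *: v + v') >> - a *: << (u, v) >> - << (u, v') >>).

Definition tensor := presented tensor_rel.
HB.instance Definition _ := GRing.Lmodule.on tensor.

Definition tens (u : U) (v : V) : tensor := pgen tensor_rel (u, v).

Definition bilinear_map (W : lmodType K) (f : U -> V -> W) :=
  (forall v, linear (f^~ v)) /\ (forall u, linear (f u)).

Lemma tens_bilinear : bilinear_map tens.
Proof.
split=> [v a u u'|u a v v']; apply/eqP; rewrite -subr_eq0 opprD addrA /tens /pgen.
  by rewrite -linearZ -!linearB /= presented_rel //; left.
by rewrite -linearZ -!linearB /= presented_rel //; right.
Qed.
HB.instance Definition _ u :=
  GRing.isLinear.Build K V tensor *:%R (tens u) (tens_bilinear.2 u).

Section Lift.
Context (W : lmodType K) (f : U -> V -> W) (Hf : bilinear_map f).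

Lemma tensor_lift_rel x :
  tensor_rel x -> fglift (fun uv : U * V => f uv.1 uv.2) x = 0.
Proof.
by case=> [a u u' v|a u v v'];
  rewrite !linearB linearZ /= !fgliftE /= (Hf.1, Hf.2) addrAC addrK subrr.
Qed.

Definition tensor_lift : {linear tensor -> W} := presented_lift tensor_lift_rel.

Lemma tensor_liftE u v : tensor_lift (tens u v) = f u v.
Proof. exact: presented_liftE. Qed.
End Lift.

Lemma tensor_ext (W : lmodType K) (f g : {linear tensor -> W}) :
  (forall u v, f (tens u v) = g (tens u v)) -> f =1 g.
Proof. by move=> fg; apply: presented_ext => -[u v]; apply: fg. Qed.

End Tensor.

Section TensorMap.
Context (K : fieldType) (U V U' V' : lmodType K).
Context (S : {linear U -> U'}) (T : {linear V -> V'}).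

Lemma tensor_map_bilinear : bilinear_map (fun u v => tens (S u) (T v)).
Proof.
by split=> [v|u] a x y; rewrite linearP ((tens_bilinear _ _).1, (tens_bilinear _ _).2).
Qed.

Definition tensor_map : {linear tensor U V -> tensor U' V'} :=
  tensor_lift tensor_map_bilinear.

Lemma tensor_mapE u v : tensor_map (tens u v) = tens (S u) (T v).
Proof. exact: tensor_liftE. Qed.
End TensorMap.

(* The data (X, p, xi): p is idempotent with range the line spanned by xi, so
   that X is the direct sum of that line and of the kernel of p (sv_ring). *)
Record svspace (K : fieldType) := SVSpace {
  sv_car :> lmodType K;
  sv_p : {linear sv_car -> sv_car};
  sv_xi : sv_car;
  sv_xi_neq0 : sv_xi != 0;
  sv_p_xi : sv_p sv_xi = sv_xi;
  sv_p_range : forall x, exists c, sv_p x = c *: sv_xi }.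
Arguments sv_p {K s}.
Arguments sv_xi {K s}.

Section SVSpace.
Context (K : fieldType) (X : svspace K).

(* Since sv_xi != 0, this is the unique c with sv_p x = c *: sv_xi. *)
Definition sv_coef (x : X) : K := projT1 (cid (sv_p_range x)).

Lemma sv_coefE x : sv_p x = sv_coef x *: sv_xi.
Proof. exact: projT2 (cid (sv_p_range x)). Qed.

Definition sv_state (T : {linear X -> X}) : K := sv_coef (T sv_xi).

Lemma sv_coef_uniq x c : sv_p x = c *: sv_xi -> sv_coef x = c.
Proof.
rewrite sv_coefE => /eqP; rewrite -subr_eq0 -scalerBl scaler_eq0.
by rewrite (negPf (sv_xi_neq0 X)) orbF subr_eq0 => /eqP.
Qed.

Lemma sv_coef_linear : linear_for *%R sv_coef.
Proof.
move=> a x y; apply: sv_coef_uniq.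
by rewrite linearP /= !sv_coefE scalerDl scalerA.
Qed.
HB.instance Definition _ := GRing.isLinear.Build K X K *%R sv_coef sv_coef_linear.

Lemma sv_coef_xi : sv_coef sv_xi = 1.
Proof. by apply: sv_coef_uniq; rewrite sv_p_xi scale1r. Qed.

Definition sv_ring_pred : {pred X} := fun x => sv_p x == 0.
Lemma sv_ring_submod : submod_closed sv_ring_pred.
Proof.
split=> [|a x y]; rewrite !unfold_in ?linear0 // => /eqP px /eqP py.
by rewrite linearP /= px py scaler0 addr0.
Qed.
HB.instance Definition _ :=
  GRing.isSubmodClosed.Build K X sv_ring_pred sv_ring_submod.

Record sv_ring := SVRing { sv_ring_val :> X; _ : sv_ring_val \in sv_ring_pred }.
HB.instance Definition _ := [isSub for sv_ring_val].
HB.instance Definition _ := [Choice of sv_ring by <:].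
HB.instance Definition _ := [SubChoice_isSubLmodule of sv_ring by <:].

Lemma sv_proj_subproof (x : X) : x - sv_p x \in sv_ring_pred.
Proof.
by rewrite unfold_in linearB /= (sv_coefE x) linearZ /= sv_p_xi subrr.
Qed.
Definition sv_proj (x : X) : sv_ring := SVRing (sv_proj_subproof x).

Lemma sv_proj_linear : linear sv_proj.
Proof.
move=> a x y; apply: val_inj; rewrite /= linearP /= scalerBr opprD !addrA.
by congr (_ - _); rewrite addrAC.
Qed.
HB.instance Definition _ := GRing.isLinear.Build K X sv_ring *:%R sv_proj sv_proj_linear.

Lemma sv_decomp x : x = sv_coef x *: sv_xi + val (sv_proj x).
Proof. by rewrite -sv_coefE addrC subrK. Qed.

Lemma sv_coef_ring (y : sv_ring) : sv_coef (val y) = 0.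
Proof. by apply: sv_coef_uniq; rewrite scale0r; apply/eqP; case: y. Qed.
Lemma sv_proj_ring (y : sv_ring) : sv_proj (val y) = y.
Proof.
by apply: val_inj; rewrite [RHS]sv_decomp sv_coef_ring scale0r add0r.
Qed.
Lemma sv_proj_xi : sv_proj sv_xi = 0.
Proof. by apply: val_inj; rewrite /= sv_p_xi subrr. Qed.

End SVSpace.

Definition alternating (w : seq bool) : bool := sorted (fun d e => d != e) w.

Section FreeProduct.
Context (K : fieldType) (X : bool -> svspace K).

(* The two spaces X', X'' are X false, X true. A word in vectors of the kernels
   stands for the elementary tensor of its letters. *)
Definition letter := {d : bool & sv_ring (X d)}.
HB.instance Definition _ := Choice.on letter.

Definition mkletter d (x : sv_ring (X d)) : letter :=
  Tagged (fun d => sv_ring (X d)) x.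

Definition tags (s : seq letter) : seq bool := map tag s.

Definition letterwise_linear (W : lmodType K) (f : seq letter -> W) :=
  forall s1 s2 d, linear (fun x : sv_ring (X d) => f (s1 ++ mkletter x :: s2)).

Lemma letterwise0 (W : lmodType K) (f : seq letter -> W) s1 s2 d :
  letterwise_linear f -> f (s1 ++ mkletter (0 : sv_ring (X d)) :: s2) = 0.
Proof.
move=> Hf; have := Hf s1 s2 d (-1) 0 0.
by rewrite scaler0 addr0 scaleN1r addNr.
Qed.

Section Summands.
Context (Q : pred (seq bool)).

Definition admissible (s : seq letter) : bool := alternating (tags s) && Q (tags s).

Definition word := {s : seq letter | admissible s}.
HB.instance Definition _ := Choice.on word.
HB.instance Definition _ := SubType.on word.

(* The quotient by multilinearity in each letter of the free vector space on the
   words whose index sequence w is alternating and satisfies Q is the direct sum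
   over such w of the tensor products of the kernels indexed by w; the empty w
   contributes the line spanned by the empty word. *)
Inductive word_rel : {freeg word / K} -> Prop :=
| WordRel s1 s2 d a (x y : sv_ring (X d)) (w w1 w2 : word)
    of val w = s1 ++ mkletter (a *: x + y) :: s2
    & val w1 = s1 ++ mkletter x :: s2 & val w2 = s1 ++ mkletter y :: s2 :
    word_rel (<< w >> - a *: << w1 >> - << w2 >>).

Definition summands := presented word_rel.
HB.instance Definition _ := GRing.Lmodule.on summands.

(* The elementary tensor of s, extended by 0 to inadmissible sequences. *)
Definition pure (s : seq letter) : summands :=
  if insub s is Some w then pgen word_rel w else 0.

Lemma admissibleE s1 s2 d (x y : sv_ring (X d)) :
  admissible (s1 ++ mkletter x :: s2) = admissible (s1 ++ mkletter y :: s2).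
Proof. by rewrite /admissible /tags !map_cat. Qed.

Lemma pure_linear : letterwise_linear pure.
Proof.
move=> s1 s2 d a x y; rewrite /pure.
have [ok|nok] := boolP (admissible (s1 ++ mkletter x :: s2)); last first.
  by rewrite !insubN ?scaler0 ?addr0 // (admissibleE _ _ _ x).
have ok1 : admissible (s1 ++ mkletter y :: s2) by rewrite (admissibleE _ _ _ x).
have ok2 : admissible (s1 ++ mkletter (a *: x + y) :: s2).
  by rewrite (admissibleE _ _ _ x).
rewrite !insubT /=; apply/eqP; rewrite -subr_eq0 opprD addrA /pgen.
rewrite -linearZ -!linearB /= presented_rel //.
exact: (@WordRel s1 s2 d a x y).
Qed.

Section Lift.
Context (W : lmodType K) (f : seq letter -> W) (Hf : letterwise_linear f).

Lemma summands_lift_rel x : word_rel x -> fglift (fun w : word => f (val w)) x = 0.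
Proof.
case=> s1 s2 d a {}x y w w1 w2 e e1 e2.
rewrite !linearB linearZ /= !fgliftE /= e e1 e2 Hf.
by rewrite addrAC addrK subrr.
Qed.

Definition summands_lift : {linear summands -> W} := presented_lift summands_lift_rel.

Lemma summands_liftE s : admissible s -> summands_lift (pure s) = f s.
Proof. by move=> ok; rewrite /pure insubT [LHS]presented_liftE. Qed.
End Lift.

Lemma summands_ext (W : lmodType K) (f g : {linear summands -> W}) :
  (forall s, admissible s -> f (pure s) = g (pure s)) -> f =1 g.
Proof.
move=> fg; apply: presented_ext => w; move: (fg (val w) (valP w)).
by rewrite /pure valK.
Qed.

End Summands.

Definition fp_all : pred (seq bool) := predT.
Definition fp_space := summands fp_all.
HB.instance Definition _ := GRing.Lmodule.on fp_space.

Definition fp_xi : fp_space := pure fp_all [::].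

Lemma fp_coef_linear : letterwise_linear (fun s => (s == [::])%:R : K^o).
Proof. by move=> [|l s1] s2 d a x y /=; rewrite scaler0 addr0. Qed.
Definition fp_coef : {linear fp_space -> K^o} := summands_lift _ fp_coef_linear.

Lemma fp_p_linear : letterwise_linear (fun s => if s is [::] then fp_xi else 0).
Proof. by move=> [|l s1] s2 d a x y /=; rewrite scaler0 addr0. Qed.
Definition fp_p : {linear fp_space -> fp_space} := summands_lift _ fp_p_linear.

Lemma fp_xi_neq0 : fp_xi != 0.
Proof.
apply/eqP => /(congr1 fp_coef); rewrite linear0 [LHS]summands_liftE //= => /eqP.
by rewrite oner_eq0.
Qed.
Lemma fp_p_xi : fp_p fp_xi = fp_xi.
Proof. exact: summands_liftE. Qed.

Lemma fp_p_coef x : fp_p x = fp_coef x *: fp_xi.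
Proof.
have lin : linear (fun x => fp_coef x *: fp_xi).
  by move=> a y z; rewrite linearP scalerDl scalerA.
pose g : {linear fp_space -> fp_space} := HB.pack (fun x => fp_coef x *: fp_xi)
  (GRing.isLinear.Build K fp_space fp_space *:%R _ lin).
apply: (@summands_ext _ _ fp_p g) => s ok /=.
rewrite !summands_liftE //; case: s {ok} => [|l s]; first by rewrite scale1r.
by rewrite scale0r.
Qed.

Lemma fp_p_range x : exists c, fp_p x = c *: fp_xi.
Proof. by exists (fp_coef x); rewrite fp_p_coef. Qed.

Definition free_product : svspace K := SVSpace fp_xi_neq0 fp_p_xi fp_p_range.

Section Copy.
Context (d : bool).

Definition not_first (w : seq bool) : bool := ohead w != Some d.
Definition not_last (w : seq bool) : bool := ohead (rev w) != Some d.

Definition space_l := summands not_first.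
HB.instance Definition _ := GRing.Lmodule.on space_l.
Definition space_r := summands not_last.
HB.instance Definition _ := GRing.Lmodule.on space_r.

(* Letters of the other copy are sent to the junk value 0. *)
Definition letter_in (l : letter) : X d :=
  let: existT e x := l in
  if e =P d is ReflectT E then ecast e (X e) E (val x) else 0.

Arguments letter_in : simpl never.

Lemma letter_in_eq (x : sv_ring (X d)) : letter_in (mkletter x) = val x.
Proof. by rewrite /letter_in /=; case: eqP => // E; rewrite eq_axiomK. Qed.

Lemma letter_in_linear e : linear (fun x : sv_ring (X e) => letter_in (mkletter x)).
Proof.
move=> a x y; rewrite /letter_in /=; case: eqP => [E|_]; last by rewrite scaler0 addr0.
by case: d / E.
Qed.

(* On x = c xi + x0, with x0 in the kernel, and on a word s not starting in the
   copy d, the natural identification sends x (x) s to c s + x0 s. *)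
Lemma Vd_word_linear (x : X d) : letterwise_linear (fun s =>
  sv_coef x *: pure fp_all s + pure fp_all (mkletter (sv_proj x) :: s)).
Proof.
move=> s1 s2 e a y z; rewrite -!cat_cons !pure_linear.
by rewrite !scalerDr !scalerA mulrC addrACA.
Qed.

Definition Vd_word x : {linear space_l -> fp_space} := summands_lift _ (Vd_word_linear x).

Lemma Vd_bilinear : bilinear_map Vd_word.
Proof.
split=> [u a x y|x]; last exact: linearP.
pose g : {linear space_l -> fp_space} := (a \*: Vd_word x \+ Vd_word y).
apply: (@summands_ext _ _ (Vd_word _) g) => s ok /=.
rewrite !summands_liftE // !linearP /= (pure_linear fp_all [::]).
by rewrite scalerDl !scalerA [sv_coef x * a]mulrC addrACA.
Qed.

Definition Vd : {linear tensor (X d) space_l -> fp_space} := tensor_lift Vd_bilinear.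

Definition Vd_inv_word (s : seq letter) : tensor (X d) space_l :=
  if s is l :: s' then
    if tag l == d then tens (letter_in l) (pure not_first s')
    else tens sv_xi (pure not_first s)
  else tens sv_xi (pure not_first [::]).

Lemma Vd_inv_linear : letterwise_linear Vd_inv_word.
Proof.
move=> [|l s1] s2 e a x y.
  rewrite /=; case: ifP => _.
    by rewrite letter_in_linear (tens_bilinear _ _).1.
  by rewrite (pure_linear not_first [::]) (tens_bilinear _ _).2.
rewrite /Vd_inv_word !cat_cons; case: ifP => _.
  by rewrite (pure_linear not_first) (tens_bilinear _ _).2.
by rewrite -!cat_cons (pure_linear not_first) (tens_bilinear _ _).2.
Qed.

Definition Vd_inv : {linear fp_space -> tensor (X d) space_l} :=
  summands_lift _ Vd_inv_linear.


Lemma admissible_not_first s (x : sv_ring (X d)) :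
  admissible not_first s = admissible fp_all (mkletter x :: s).
Proof.
rewrite /admissible /not_first /alternating /=; case: s => //= l s.
by rewrite andbT andbC (inj_eq Some_inj) eq_sym.
Qed.

Lemma Vd_pure x s : admissible not_first s ->
  Vd (tens x (pure not_first s)) =
    sv_coef x *: pure fp_all s + pure fp_all (mkletter (sv_proj x) :: s).
Proof. by move=> ok; rewrite [LHS]tensor_liftE [LHS]summands_liftE. Qed.

Lemma Vd_inv_pure s : admissible fp_all s -> Vd_inv (pure fp_all s) = Vd_inv_word s.
Proof. exact: summands_liftE. Qed.


Lemma Vd_inv_not_first s : admissible not_first s ->
  Vd_inv_word s = tens sv_xi (pure not_first s).
Proof.
case: s => [|[e y] s] //=; rewrite /admissible /not_first /= => /andP[_].
by rewrite (inj_eq Some_inj) => /negPf ->.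
Qed.

Lemma VdK : cancel Vd Vd_inv.
Proof.
suff e : (Vd_inv \o Vd) =1 idfun by move=> u; have := e u.
apply: tensor_ext => x u.
pose g : {linear space_l -> tensor (X d) space_l} := tens x.
suff e : Vd_inv \o Vd \o g =1 g by exact: e.
apply: summands_ext => s ok /=; rewrite Vd_pure // linearD linearZ /=.
have ok1 : admissible fp_all s.
  by move: ok; rewrite /admissible => /andP[->].
rewrite !Vd_inv_pure -?admissible_not_first // Vd_inv_not_first //.
rewrite /= eqxx letter_in_eq.
rewrite [in RHS](sv_decomp x) -(tens_bilinear _ _).1.
done.
Qed.

Lemma Vd_invK : cancel Vd_inv Vd.
Proof.
suff e : (Vd \o Vd_inv) =1 idfun by move=> u; have := e u.
apply: summands_ext => s ok /=; rewrite Vd_inv_pure //.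
have [nf|] := boolP (admissible not_first s).
  rewrite Vd_inv_not_first // Vd_pure // sv_coef_xi sv_proj_xi scale1r.
  rewrite (letterwise0 [::] _ _ (pure_linear fp_all)) addr0.
  done.
rewrite {1}/admissible (andP ok).1 /=.
case: s ok => [|[e y] s] //= ok; rewrite /not_first /= negbK => /eqP[E].
move: y ok; rewrite {}E => y ok; rewrite eqxx.
change (Vd (tens (letter_in (mkletter y)) (pure not_first s)) =
  pure fp_all (mkletter y :: s)).
rewrite letter_in_eq Vd_pure ?(admissible_not_first _ y) //.
by rewrite sv_coef_ring sv_proj_ring scale0r add0r.
Qed.

(* Mirror image: s (x) x is sent to c s + s x0. *)
Lemma Wd_word_linear (x : X d) : letterwise_linear (fun s =>
  sv_coef x *: pure fp_all s + pure fp_all (rcons s (mkletter (sv_proj x)))).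
Proof.
move=> s1 s2 e a y z; rewrite !rcons_cat !rcons_cons !pure_linear.
by rewrite !scalerDr !scalerA mulrC addrACA.
Qed.

Definition Wd_word x : {linear space_r -> fp_space} :=
  summands_lift _ (Wd_word_linear x).

Lemma Wd_bilinear : bilinear_map (fun u x => Wd_word x u).
Proof.
split=> [x|u a x y]; first exact: linearP.
pose g : {linear space_r -> fp_space} := (a \*: Wd_word x \+ Wd_word y).
apply: (@summands_ext _ _ (Wd_word _) g) => s ok /=.
rewrite !summands_liftE // !linearP /= -!cats1 (pure_linear fp_all s).
by rewrite scalerDl !scalerA [sv_coef x * a]mulrC addrACA.
Qed.

Definition Wd : {linear tensor space_r (X d) -> fp_space} := tensor_lift Wd_bilinear.

Definition Wd_inv_word (s : seq letter) : tensor space_r (X d) :=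
  if rev s is l :: s' then
    if tag l == d then tens (pure not_last (rev s')) (letter_in l)
    else tens (pure not_last s) sv_xi
  else tens (pure not_last [::]) sv_xi.

Lemma Wd_inv_linear : letterwise_linear Wd_inv_word.
Proof.
move=> s1 s2 e a x y; case/lastP: s2 => [|s2 l].
  rewrite /Wd_inv_word !rev_cat !rev_cons /=; case: ifP => _.
    by rewrite letter_in_linear (tens_bilinear _ _).2.
  by rewrite pure_linear (tens_bilinear _ _).1.
rewrite /Wd_inv_word -!rcons_cons -!rcons_cat !rev_rcons /= !revK.
case: ifP => _.
  by rewrite pure_linear (tens_bilinear _ _).1.
by rewrite !rcons_cat !rcons_cons pure_linear (tens_bilinear _ _).1.
Qed.

Definition Wd_inv : {linear fp_space -> tensor space_r (X d)} :=
  summands_lift _ Wd_inv_linear.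

Lemma alternating_rev w : alternating (rev w) = alternating w.
Proof.
by rewrite /alternating rev_sorted; apply: eq_sorted => x y /=; rewrite eq_sym.
Qed.

Lemma admissible_not_last s (x : sv_ring (X d)) :
  admissible not_last s = admissible fp_all (rcons s (mkletter x)).
Proof.
rewrite /admissible /not_last /tags map_rcons -!(alternating_rev (_ s)).
rewrite -(alternating_rev (rcons _ _)) rev_rcons andbT -/(tags s).
rewrite /alternating; case: (rev (tags s)) => //= e w.
by rewrite andbC (inj_eq Some_inj) eq_sym.
Qed.

Lemma Wd_pure x s : admissible not_last s ->
  Wd (tens (pure not_last s) x) =
    sv_coef x *: pure fp_all s + pure fp_all (rcons s (mkletter (sv_proj x))).
Proof. by move=> ok; rewrite [LHS]tensor_liftE [LHS]summands_liftE. Qed.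

Lemma Wd_inv_pure s : admissible fp_all s -> Wd_inv (pure fp_all s) = Wd_inv_word s.
Proof. exact: summands_liftE. Qed.

Lemma Wd_inv_not_last s : admissible not_last s ->
  Wd_inv_word s = tens (pure not_last s) sv_xi.
Proof.
case/lastP: s => [|s [e y]] //; rewrite /admissible /not_last => /andP[_].
rewrite /Wd_inv_word /tags map_rcons !rev_rcons /=.
by rewrite (inj_eq Some_inj) => /negPf ->.
Qed.

Lemma WdK : cancel Wd Wd_inv.
Proof.
suff e : (Wd_inv \o Wd) =1 idfun by move=> u; have := e u.
apply: tensor_ext => u x.
pose tx (v : space_r) := tens v x.
have lin : linear tx by apply: (tens_bilinear _ _).1.
pose g : {linear space_r -> tensor space_r (X d)} :=
  HB.pack tx (GRing.isLinear.Build K _ _ *:%R tx lin).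
suff e : Wd_inv \o Wd \o g =1 g by exact: e.
apply: summands_ext => s ok /=; rewrite /tx Wd_pure // linearD linearZ /=.
have ok1 : admissible fp_all s.
  by move: ok; rewrite /admissible => /andP[->].
rewrite !Wd_inv_pure -?admissible_not_last // Wd_inv_not_last //.
rewrite /Wd_inv_word rev_rcons /= eqxx revK letter_in_eq.
by rewrite [in RHS](sv_decomp x) -(tens_bilinear _ _).2.
Qed.

Lemma Wd_invK : cancel Wd_inv Wd.
Proof.
suff e : (Wd \o Wd_inv) =1 idfun by move=> u; have := e u.
apply: summands_ext => s ok /=; rewrite Wd_inv_pure //.
have [nl|] := boolP (admissible not_last s).
  rewrite Wd_inv_not_last // Wd_pure // sv_coef_xi sv_proj_xi scale1r -cats1.
  by rewrite (letterwise0 _ _ _ (pure_linear fp_all)) addr0.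
rewrite {1}/admissible (andP ok).1 /=.
case/lastP: s ok => [|s [e y]] //= ok.
rewrite /not_last /tags map_rcons rev_rcons /= negbK => /eqP[E].
move: y ok; rewrite {}E => y ok.
rewrite /Wd_inv_word rev_rcons /= eqxx revK.
rewrite -/(mkletter y) letter_in_eq Wd_pure ?(admissible_not_last _ y) //.
by rewrite sv_coef_ring sv_proj_ring scale0r add0r.
Qed.

Definition lambda (T : {linear X d -> X d}) : {linear free_product -> free_product} :=
  Vd \o tensor_map T idfun \o Vd_inv.

Definition rho (T : {linear X d -> X d}) : {linear free_product -> free_product} :=
  Wd \o tensor_map idfun T \o Wd_inv.

End Copy.
End FreeProduct.

Definition face := bool.
Definition lft : face := false.
Definition rgt : face := true.

Record two_faced (A : Type) := TwoFaced { left_el : A; right_el : A }.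

Definition tf_el (A : Type) (w : two_faced A) (c : face) : A :=
  if c == lft then left_el w else right_el w.
Coercion tf_el : two_faced >-> Funclass.

Definition unital_hom (K : fieldType) (V : lmodType K)
    (h : {poly K} -> {linear V -> V}) : Prop :=
  [/\ forall a P Q v, h (a *: P + Q) v = a *: h P v + h Q v,
      forall v, h 1 v = v
    & forall P Q v, h (P * Q) v = h P (h Q v)].

Section BiFree.
Context (K : fieldType).

Section Model.
Context (X : bool -> svspace K).
Context (l r : forall d, {poly K} -> {linear X d -> X d}).

Definition model_op (c : bool * face) : {linear free_product X -> free_product X} :=
  if c.2 == lft then lambda (l c.1 'X) else rho (r c.1 'X).

Definition model_word (s : seq (bool * face)) :
    {linear free_product X -> free_product X} :=
  foldr (fun c (T : {linear free_product X -> free_product X}) =>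
    model_op c \o T : {linear free_product X -> free_product X}) idfun s.
End Model.

(* A unital homomorphism out of the polynomials in one formal variable plays the
   role of l^d or r^d; the pair z1, z2 is indexed by false, true. The equality of
   joint distributions is the equality of all mixed moments. *)
Definition bifree (A : algType K) (phi : A -> K) (z1 z2 : two_faced A) : Prop :=
  exists (X : bool -> svspace K)
         (l r : forall d, {poly K} -> {linear X d -> X d}),
  [/\ forall d, unital_hom (l d), forall d, unital_hom (r d)
    & forall s : seq (bool * face),
        sv_state (model_word l r s) =
        phi (\prod_(c <- s) (if c.1 then z2 else z1) c.2)].
End BiFree.

Section NonCrossing.

Definition noncrossing (T : finType) (pos : T -> nat) (P : {set {set T}}) : bool :=
  [forall V in P, forall W in P, (V != W) ==>
    ~~ [exists a in V, exists b in W, exists c in V, exists d in W,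
          (pos a < pos b < pos c)%N && (pos c < pos d)%N]].

Lemma noncrossingP (T : finType) (pos : T -> nat) (P : {set {set T}}) :
  reflect (forall V W, V \in P -> W \in P -> forall a b c d,
             a \in V -> b \in W -> c \in V -> d \in W ->
             (pos a < pos b)%N -> (pos b < pos c)%N -> (pos c < pos d)%N -> V = W)
    (noncrossing pos P).
Proof.
apply: (iffP 'forall_in_forall_inP) => [nc V W VP WP a b c d aV bW cV dW ab bc cd|nc].
  apply/eqP; apply: contraT => VW; have /implyP/(_ VW)/negP := nc V VP W WP.
  case; apply/exists_inP; exists a => //; apply/exists_inP; exists b => //.
  apply/exists_inP; exists c => //; apply/exists_inP; exists d => //.
  by rewrite ab bc cd.
move=> V VP W WP; apply/implyP => VW; apply/negP => /exists_inP[a aV].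
move=> /exists_inP[b bW] /exists_inP[c cV] /exists_inP[d dW] /andP[/andP[ab bc] cd].
by move/eqP: VW; apply; apply: (nc _ _ VP WP a b c d).
Qed.

Context (n : nat).
Implicit Types sigma tau pi : {set {set 'I_n}}.

Definition NC : {set {set {set 'I_n}}} :=
  [set sigma | partition sigma [set: 'I_n] & noncrossing val sigma].

(* Positions in the order 1 < bar 1 < 2 < bar 2 < ...; inr i is bar i. *)
Definition bar_pos (x : 'I_n + 'I_n) : nat :=
  match x with inl i => i.*2 | inr i => i.*2.+1 end.

Definition bar_union sigma tau : {set {set 'I_n + 'I_n}} :=
  [set inl @: (V : {set 'I_n}) | V in sigma] :|:
  [set inr @: (V : {set 'I_n}) | V in tau].

Definition refines tau1 tau2 : bool :=
  [forall V in tau1, exists W in tau2, V \subset W].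

Definition is_kreweras sigma tau : bool :=
  [&& tau \in NC, noncrossing bar_pos (bar_union sigma tau) &
      [forall tau1 in NC, noncrossing bar_pos (bar_union sigma tau1) ==>
                          refines tau1 tau]].

(* By K_NCP below the default value is not reached for sigma in NC. *)
Definition K_NC sigma : {set {set 'I_n}} := odflt set0 [pick tau | is_kreweras sigma tau].

Let krel sigma (i j : 'I_n) : bool :=
  [forall V in sigma, forall x in V, forall y in V,
     ((x <= i) (+) (x <= j))%N == ((y <= i) (+) (y <= j))%N].

Let krelP sigma (i j : 'I_n) : reflect
  (forall V (x y : 'I_n), V \in sigma -> x \in V -> y \in V ->
   ((x <= i) (+) (x <= j))%N = ((y <= i) (+) (y <= j))%N) (krel sigma i j).
Proof.
apply: (iffP forall_inP) => [h V x y VS xV yV|h V VS].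
  by have /forall_inP/(_ _ xV)/forall_inP/(_ _ yV)/eqP := h V VS.
by apply/forall_inP => x xV; apply/forall_inP => y yV; apply/eqP/(h V).
Qed.

Let krel_equiv sigma : {in [set: 'I_n] & &, equivalence_rel (krel sigma)}.
Proof.
move=> i j k _ _ _; split.
  by apply/krelP => V x y _ _ _; rewrite !addbb.
move=> /krelP ij; apply/krelP/krelP => h V x y VS xV yV;
  have := ij V x y VS xV yV; have := h V x y VS xV yV;
  by move: (x <= i)%N (x <= j)%N (x <= k)%N (y <= i)%N (y <= j)%N (y <= k)%N;
  do 6!case.
Qed.

Lemma K_NCP sigma : sigma \in NC -> is_kreweras sigma (K_NC sigma).
Proof.
rewrite inE => /andP[parS /noncrossingP ncS]; rewrite /K_NC.
case: pickP => // /(_ (equivalence_partition (krel sigma) [set: 'I_n])) /negP[].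
set tau := equivalence_partition _ _.
have parT : partition tau setT by apply: equivalence_partitionP => ? ? ?; apply: krel_equiv.
have eqT (i j : 'I_n) V : V \in tau -> i \in V -> j \in V -> krel sigma i j.
  move=> VT iV jV; have := pblock_equivalence_partition (@krel_equiv sigma) (in_setT i) (in_setT j).
  by move=> <-; rewrite (def_pblock (partition_trivIset parT) VT iV).
have Teq (i j : 'I_n) V W : V \in tau -> W \in tau -> i \in V -> j \in W ->
    krel sigma i j -> V = W.
  move=> VT WT iV jW; rewrite -(pblock_equivalence_partition (@krel_equiv sigma)) ?inE //.
  rewrite (def_pblock (partition_trivIset parT) VT iV) => jV.
  have tr := partition_trivIset parT.
  by rewrite -(def_pblock tr VT jV) (def_pblock tr WT jW).
have ncT (V W : {set 'I_n}) : V \in tau -> W \in tau -> forall a b c d : 'I_n,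
    a \in V -> b \in W -> c \in V -> d \in W ->
    (a < b)%N -> (b < c)%N -> (c < d)%N -> V = W.
  move=> VT WT a b c d aV bW cV dW ab bc cd; apply: (Teq a b) => //.
  have /krelP ac := eqT _ _ _ VT aV cV; have /krelP bd := eqT _ _ _ WT bW dW.
  apply/krelP => U x y US xU yU.
  have m (z p q : 'I_n) : (p < q)%N -> (z <= p)%N ==> (z <= q)%N.
    by move=> pq; apply/implyP => zp; apply: leq_trans zp (ltnW pq).
  move: (ac U x y US xU yU) (bd U x y US xU yU).
  move: (m x _ _ ab) (m x _ _ bc) (m x _ _ cd) (m y _ _ ab) (m y _ _ bc) (m y _ _ cd).
  move: (x <= a)%N (x <= b)%N (x <= c)%N (x <= d)%N.
  by move: (y <= a)%N (y <= b)%N (y <= c)%N (y <= d)%N; do 8!case.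
apply/and3P; split.
- by rewrite inE parT; apply/noncrossingP.
- apply/noncrossingP => V W; rewrite !inE.
  move=> /orP[] /imsetP[V0 V0P ->] /orP[] /imsetP[W0 W0P ->] a b c d
    /imsetP[a0 aV ->] /imsetP[b0 bW ->] /imsetP[c0 cV ->] /imsetP[d0 dW ->] /=.
  + rewrite !ltn_double => ab bc cd; have -> // : V0 = W0.
    exact: (ncS _ _ V0P W0P a0 b0 c0 d0).
  + rewrite !ltnS !leq_double ltn_Sdouble => ab bc cd.
    have /krelP/(_ V0 a0 c0 V0P aV cV) := eqT _ _ _ W0P bW dW.
    rewrite ab cd (leq_trans ab) ?(leq_trans (ltnW bc)) //.
    by rewrite leqNgt bc.
  + rewrite !ltn_Sdouble ltnS leq_double => ab bc cd.
    have /krelP/(_ W0 b0 d0 W0P bW dW) := eqT _ _ _ V0P aV cV.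
    rewrite bc [(d0 <= c0)%N]leqNgt cd [(b0 <= a0)%N]leqNgt ab.
    by rewrite leqNgt (leq_trans ab) // (leq_trans bc) // ltnW.
  + rewrite !ltnS !ltn_double => ab bc cd; have -> // : V0 = W0.
    exact: (ncT _ _ V0P W0P a0 b0 c0 d0).
apply/forall_inP => tau1; rewrite inE => /andP[parT1 _].
apply/implyP => /noncrossingP nc1; apply/forall_inP => W WT1.
have /and3P[_ _ n0] := parT1.
have /set0Pn[i iW] : W != set0 by apply: contraNneq n0 => <-.
have sub V x y (i1 j1 : 'I_n) : V \in sigma -> x \in V -> y \in V -> i1 \in W -> j1 \in W ->
   (i1 < x)%N -> (x <= j1)%N -> ~~ ((i1 < y) && (y <= j1))%N -> False.
  move=> VS xV yV i1W j1W ix xj yn.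
  have VU : inl @: V \in bar_union sigma tau1 by rewrite inE imset_f.
  have WU : inr @: W \in bar_union sigma tau1 by rewrite inE imset_f ?orbT.
  have VW : inl @: V = inr @: W -> False.
    by move=> e; have := imset_f (@inl 'I_n 'I_n) xV; rewrite e => /imsetP[].
  have [yi|iy] := leqP y i1.
    apply: VW; apply: (nc1 _ _ VU WU (inl y) (inr i1) (inl x) (inr j1));
      by rewrite ?imset_f //= ?ltn_Sdouble // ltnS leq_double.
  move: yn; rewrite iy -ltnNge => jy.
  apply: VW; apply/esym; apply: (nc1 _ _ WU VU (inr i1) (inl x) (inr j1) (inl y));
    by rewrite ?imset_f //= ?ltn_Sdouble // ltnS leq_double.
apply/exists_inP; exists (pblock tau i).
  by rewrite pblock_mem // (cover_partition parT) inE.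
apply/subsetP => j jW.
rewrite (pblock_equivalence_partition (@krel_equiv sigma)) ?inE //.
apply/krelP => V x y VS xV yV.
have h1 := sub V x y i j VS xV yV iW jW; have h2 := sub V x y j i VS xV yV jW iW.
have h3 := sub V y x i j VS yV xV iW jW; have h4 := sub V y x j i VS yV xV jW iW.
move: h1 h2 h3 h4; rewrite !ltnNge.
by move: (x <= i)%N (x <= j)%N (y <= i)%N (y <= j)%N => [] [] [] [] // h1 h2 h3 h4;
  first [case: (h1 isT isT isT) | case: (h2 isT isT isT)
        |case: (h3 isT isT isT) | case: (h4 isT isT isT)].
Qed.

Definition act_part (s : 'S_n) pi : {set {set 'I_n}} :=
  [set s @: (V : {set 'I_n}) | V in pi].

Section Chi.
Context (chi : 'I_n -> face).

(* The list s_chi(1), ..., s_chi(n). *)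
Definition s_chi_seq : seq 'I_n :=
  [seq i <- enum 'I_n | chi i == lft] ++ rev [seq i <- enum 'I_n | chi i == rgt].

Lemma s_chi_perm_eq : perm_eq s_chi_seq (enum 'I_n).
Proof.
rewrite /s_chi_seq.
have e : [seq i <- enum 'I_n | chi i == rgt] = filter (predC (fun i => chi i == lft)) (enum 'I_n).
  by apply: eq_filter => i /=; case: (chi i).
rewrite e; apply: perm_trans (perm_cat (perm_refl _) (permEl (perm_rev _))) _.
by rewrite perm_filterC.
Qed.

Definition s_chi_fun (k : 'I_n) : 'I_n := nth k s_chi_seq k.

Lemma s_chi_inj : injective s_chi_fun.
Proof.
have sz : size s_chi_seq = n by rewrite (perm_size s_chi_perm_eq) size_enum_ord.
move=> j k; rewrite /s_chi_fun (set_nth_default k) ?sz // => /eqP.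
rewrite nth_uniq ?sz // ?(perm_uniq s_chi_perm_eq) ?enum_uniq // => /eqP.
exact: val_inj.
Qed.

Definition s_chi : 'S_n := perm s_chi_inj.

Definition BNC : {set {set {set 'I_n}}} := [set pi | act_part s_chi^-1%g pi \in NC].

Definition K_BNC pi : {set {set 'I_n}} :=
  act_part s_chi (K_NC (act_part s_chi^-1%g pi)).
End Chi.
End NonCrossing.

(* enum_val lists V increasingly, so this is f restricted to V = {v_1 < ... < v_m}. *)
Definition restr (T : Type) n (V : {set 'I_n}) (f : 'I_n -> T) : 'I_#|V| -> T :=
  fun t => f (enum_val t).

Section Cumulants.
Context (K : fieldType) (A : algType K).

Definition multifunctional := forall n, ('I_n -> face) -> ('I_n -> A) -> K.

Definition kappa_part (kappa : multifunctional) n (chi : 'I_n -> face)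
    (pi : {set {set 'I_n}}) (a : 'I_n -> A) : K :=
  \prod_(V in pi) kappa #|V| (restr (V:=V) chi) (restr (V:=V) a).

Definition upd n (a : 'I_n -> A) (i : 'I_n) (x : A) : 'I_n -> A :=
  fun j => if j == i then x else a j.

(* The characterization of the cumulant functionals; bifree_cumulants_exist and
   bifree_cumulants_unique show that it determines kappa n for all n >= 1. *)
Definition bifree_cumulants (phi : A -> K) (kappa : multifunctional) : Prop :=
  (forall n chi (a : 'I_n -> A) i, linear_for *%R (fun x => kappa n chi (upd a i x))) /\
  (forall n chi (a : 'I_n -> A), (0 < n)%N ->
     phi (\prod_(i < n) a i) = \sum_(pi in BNC chi) kappa_part kappa chi pi a).

Lemma act_partK n (s : 'S_n) : cancel (act_part s) (act_part s^-1%g).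
Proof.
move=> pi; rewrite /act_part -imset_comp -[RHS]imset_id; apply: eq_imset => V /=.
by rewrite -imset_comp -[RHS]imset_id; apply: eq_imset => x /=; rewrite permK.
Qed.

Lemma act_partT n (s : 'S_n) : act_part s [set [set: 'I_n]] = [set setT].
Proof.
rewrite /act_part imset_set1; congr [set _].
by apply/setP => x; rewrite inE; apply/imsetP; exists (s^-1%g x); rewrite ?inE ?permKV.
Qed.

Lemma full_BNC n (chi : 'I_n -> face) : (0 < n)%N -> [set setT] \in BNC chi.
Proof.
move=> n0; rewrite inE act_partT inE; apply/andP; split.
  rewrite /partition /cover big_set1 eqxx trivIset1 inE /= eq_sym.
  by apply/set0Pn; exists (Ordinal n0); rewrite inE.
by apply/noncrossingP => V W /set1P-> /set1P->.
Qed.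

Lemma BNC_partition n (chi : 'I_n -> face) pi : pi \in BNC chi -> partition pi setT.
Proof.
rewrite inE inE => /andP[/and3P[/eqP cov tr n0] _].
set s := (s_chi chi) in cov tr n0; pose s' := (s^-1)%g.
have e : pi = act_part s (act_part s' pi).
  by rewrite -[s in RHS](invgK s) act_partK.
have inj : injective (fun V : {set 'I_n} => s @: V) := imset_inj (@perm_inj _ s).
apply/and3P; split.
- apply/eqP/setP => x; rewrite inE; apply/bigcupP.
  have : s' x \in cover (act_part s' pi) by rewrite cov inE.
  move=> /bigcupP[V VP xV]; exists (s @: V); last first.
    by apply/imsetP; exists (s' x) => //; rewrite permKV.
  by rewrite e; apply: imset_f.
- rewrite e; apply/trivIsetP => V W /imsetP[V0 V0P ->] /imsetP[W0 W0P ->] ne.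
  rewrite imset_disjoint; last exact: perm_inj.
  by move/trivIsetP: tr; apply => //; apply: contraNneq ne => ->.
by apply: contra n0 => p0; apply/imsetP; exists set0; rewrite ?imset0.
Qed.

Lemma BNC_block n (chi : 'I_n -> face) pi V :
  pi \in BNC chi -> pi != [set setT] -> V \in pi -> (0 < #|V| < n)%N.
Proof.
move=> /BNC_partition/and3P[/eqP cov tr n0] ne VP; apply/andP; split.
  by rewrite card_gt0; apply: contraNneq n0 => <-.
rewrite -[n in X in (_ < X)%N]card_ord -cardsT; apply: proper_card.
rewrite properT; apply: contraNneq ne => VT; apply/eqP/setP => W.
rewrite inE; apply/idP/eqP => [WP|->]; last by rewrite -VT.
move/trivIsetP/(_ V W VP WP): tr; case: eqVneq => [<- // _|_ /(_ isT)].
rewrite VT -setI_eq0 setTI => /eqP W0.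
by move: n0; rewrite -W0 WP.
Qed.

Lemma multifunctional_setT (kappa : multifunctional) n chi (a : 'I_n -> A) :
  kappa #|[set: 'I_n]| (restr (V:=setT) chi) (restr (V:=setT) a) = kappa n chi a.
Proof.
have H m (g : 'I_m -> 'I_n) : m = n -> (forall t, val (g t) = val t) ->
    kappa m (fun t => chi (g t)) (fun t => a (g t)) = kappa n chi a.
  move=> mn; case: n / mn chi a g => chi a g ge.
  have -> : (fun t => chi (g t)) = chi.
    by apply/funext => t; congr chi; apply: val_inj.
  by have -> : (fun t => a (g t)) = a by apply/funext => t; congr a; apply: val_inj.
have e : #|[set: 'I_n]| = n by rewrite cardsT card_ord.
apply: H => // t; rewrite (enum_val_nth (enum_val t)) enum_setT -enumT /=.
by rewrite nth_enum_ord // -[X in (_ < X)%N]e ltn_ord.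
Qed.

Lemma sum_BNC (kappa : multifunctional) n chi (a : 'I_n -> A) : (0 < n)%N ->
  \sum_(pi in BNC chi) kappa_part kappa chi pi a =
  kappa n chi a + \sum_(pi in BNC chi | pi != [set setT]) kappa_part kappa chi pi a.
Proof.
move=> n0; rewrite (bigD1 [set setT]) ?full_BNC //=; congr (_ + _).
by rewrite /kappa_part big_set1 multifunctional_setT.
Qed.

Section Existence.
Context (phi : {scalar A}).

Fixpoint kappa_rec (N : nat) : multifunctional := fun n chi a =>
  if N is N'.+1 then
    phi (\prod_(i < n) a i) -
    \sum_(pi in BNC chi | pi != [set setT]) kappa_part (kappa_rec N') chi pi a
  else 0.

Definition kappa_of : multifunctional := fun n => kappa_rec n (n:=n).

Lemma kappa_recE N n chi (a : 'I_n -> A) :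
  (0 < n <= N)%N -> kappa_rec N chi a = kappa_of chi a.
Proof.
elim/ltn_ind: N n chi a => N IH [//|n] chi a; case: N IH => [//|N] IH nN.
rewrite /kappa_of /=; congr (_ - _); apply: eq_bigr => pi /andP[piB pine].
apply: eq_bigr => V VP; have /andP[V0 Vn] := BNC_block piB pine VP.
have Vle : (#|V| <= n)%N by [].
have nle : (n <= N)%N by case/andP: nN.
by rewrite (IH N) ?V0 ?(leq_trans Vle) // (IH n) ?V0.
Qed.

Lemma prod_upd_linear n (a : 'I_n -> A) i : linear (fun x => \prod_(j < n) upd a i x j).
Proof.
have [s1 [s2 [e n1 n2]]] : exists s1 s2,
    [/\ index_enum 'I_n = s1 ++ i :: s2, i \notin s1 & i \notin s2].
  have := index_enum_uniq 'I_n; case/splitPr: (mem_index_enum i) => s1 s2.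
  rewrite cat_uniq /= negb_or => /and4P[_ /andP[n1 _] n2 _].
  by exists s1, s2.
have upd_out s x : i \notin s -> \prod_(j <- s) upd a i x j = \prod_(j <- s) a j.
  move=> ni; apply: eq_big_seq => j js; rewrite /upd.
  by case: eqP js ni => // -> ->.
move=> c x y; rewrite e !big_cat !big_cons /= !upd_out // /upd eqxx.
by rewrite mulrDl mulrDr -scalerAl -scalerAr.
Qed.

Lemma restr_upd_out n (V : {set 'I_n}) (a : 'I_n -> A) i x : i \notin V ->
  restr (V:=V) (upd a i x) = restr (V:=V) a.
Proof.
move=> iV; apply/funext => t; rewrite /restr /upd.
by case: eqP (enum_valP t) iV => // -> ->.
Qed.

Lemma restr_upd_in n (V : {set 'I_n}) (a : 'I_n -> A) i x (iV : i \in V) :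
  restr (V:=V) (upd a i x) = upd (restr (V:=V) a) (enum_rank_in iV i) x.
Proof.
apply/funext => t; rewrite /restr /upd; congr (if _ then _ else _).
apply/eqP/eqP => [ti|->].
  by apply: enum_val_inj; rewrite enum_rankK_in ?ti.
by rewrite enum_rankK_in.
Qed.

Lemma kappa_rec_linear N n chi (a : 'I_n -> A) i :
  linear_for *%R (fun x => kappa_rec N chi (upd a i x)).
Proof.
elim: N n chi a i => [|N IH] n chi a i c x y /=; first by rewrite mulr0 addr0.
rewrite prod_upd_linear linearP /= mulrBr mulr_sumr addrACA -opprD -big_split /=.
congr (_ - _); apply: eq_bigr => pi /andP[/BNC_partition parp _].
have ic : i \in cover pi by rewrite (cover_partition parp) inE.
have Vp := pblock_mem ic; have iV : i \in pblock pi i by rewrite mem_pblock.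
rewrite /kappa_part !(bigD1 _ Vp) /= !restr_upd_in IH mulrDl mulrA.
have out z : \prod_(V in pi | V != pblock pi i)
    kappa_rec N (restr (V:=V) chi) (restr (V:=V) (upd a i z)) =
    \prod_(V in pi | V != pblock pi i) kappa_rec N (restr (V:=V) chi) (restr (V:=V) a).
  apply: eq_bigr => V /andP[VP Vne]; rewrite restr_upd_out //.
  by apply: contraNN Vne => iV'; rewrite (def_pblock (partition_trivIset parp) VP iV').
by rewrite !out.
Qed.

Lemma bifree_cumulants_exist : bifree_cumulants phi kappa_of.
Proof.
split=> [n chi a i|n chi a n0]; first exact: kappa_rec_linear.
rewrite sum_BNC // {1}/kappa_of; case: n chi a n0 => [//|n] chi a _ /=.
rewrite addrAC -addrA -sumrB -[LHS]addr0; congr (_ + _).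
rewrite big1 // => pi /andP[piB pine].
apply/eqP; rewrite subr_eq0; apply/eqP; apply: eq_bigr => V VP.
have /andP[V0 Vn] := BNC_block piB pine VP.
by rewrite kappa_recE ?V0.
Qed.

Lemma bifree_cumulants_unique k1 k2 :
  bifree_cumulants phi k1 -> bifree_cumulants phi k2 ->
  forall n chi (a : 'I_n -> A), (0 < n)%N -> k1 n chi a = k2 n chi a.
Proof.
move=> [_ h1] [_ h2]; elim/ltn_ind => n IH chi a n0.
have := h1 n chi a n0; rewrite (h2 n chi a n0) !sum_BNC //.
rewrite [X in _ + X = _](eq_bigr (fun pi => kappa_part k1 chi pi a)) => [/addIr->//|].
move=> pi /andP[piB pine]; apply: eq_bigr => V VP.
by have /andP[V0 Vn] := BNC_block piB pine VP; rewrite IH.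
Qed.
End Existence.
End Cumulants.

(* Main.v *)
Require Import Defs.
From mathcomp Require Import all_boot all_algebra all_fingroup.
From mathcomp Require Import boolp reals.
From mathcomp.real_closed Require Import complex.
Set Implicit Arguments.
Unset Strict Implicit.
Unset Printing Implicit Defensive.
Import GRing.Theory.
Local Open Scope ring_scope.

(** Replace every index i by its two factors, (i, false) for z' and (i, true) for z''. In the
    order of s_chi the face of an index no longer matters: a bi-non-crossing partition is a
    partition without crossings for chi_pos, and as the right face multiplies in the opposite
    order, the doubled indices appear as (i, false) < (i, true) on both faces. So the moments
    of z are mixed moments of z' and z'' along a list whose colours alternate in this order.

    Mixed moments. Cut a list of factors into label classes that are intervals of the order
    with alternating colours, and centre each class by the alternating sum that deletes
    classes against their scalar moments. In a free product of spaces the centred word sends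
    the vacuum to an elementary tensor of vectors in the kernels (centred_model), so its moment
    vanishes. The same centring of a sum over non-crossing partitions keeps those for which no
    class is a union of blocks, and there is none with monochromatic blocks
    (parity_saturated). These relations determine mixed moments from those of one colour, so
    every mixed moment is the sum over the non-crossing partitions with monochromatic blocks of
    the products of the cumulants of their blocks (mixed_moment_ncsum).

    Combinatorics. A non-crossing partition P of the doubled indices has a unique finest
    non-crossing partition Q of the indices whose preimage it refines, and over each block of Q
    it is indecomposable. Sorting by Q turns the moments of z into a moment-cumulant formula
    with the sums over indecomposable partitions in the place of cumulants (ncsum_preimset).
    Moments determine cumulants (ncsum_inj), so these sums are the cumulants of z. Finally an
    indecomposable partition with monochromatic blocks is a pair of a partition pi on the first
    layer and a partition on the second one, necessarily the Kreweras complement of pi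
    (kreweras_indecomposable, indecomposable_kreweras). *)

(** * Partitions and saturated sets *)

Section Partitions.
Variable T : finType.
Implicit Types (S I V W B C : {set T}) (P Q R : {set {set T}}).

Lemma partition_intro P S :
  (forall B, B \in P -> B != set0) ->
  (forall B, B \in P -> B \subset S) ->
  (forall x, x \in S -> exists2 B, B \in P & x \in B) ->
  (forall B C x, B \in P -> C \in P -> x \in B -> x \in C -> B = C) ->
  partition P S.
Proof.
move=> n0 sub cov tr; apply/and3P; split.
- apply/eqP/setP => x; apply/bigcupP/idP => [[B BP xB]|/cov[B]]; last by exists B.
  exact: (subsetP (sub B BP)).
- apply/trivIsetP => B C BP CP; apply: contraR => /pred0Pn[x /andP[xB xC]].
  by apply/eqP; apply: (tr B C x).
by apply/negP => /n0; rewrite eqxx.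
Qed.

Lemma partition_cover P S x : partition P S -> x \in S -> exists2 B, B \in P & x \in B.
Proof. by move=> pP; rewrite -(cover_partition pP) => /bigcupP[B]; exists B. Qed.

Lemma partition_eq P S B C x :
  partition P S -> B \in P -> C \in P -> x \in B -> x \in C -> B = C.
Proof.
move=> pP BP CP xB xC; have tr := partition_trivIset pP.
by rewrite -(def_pblock tr BP xB) (def_pblock tr CP xC).
Qed.

Lemma partition_block P S B : partition P S -> B \in P -> exists x, x \in B.
Proof. by move=> pP /(partition_neq0 pP)/set0Pn. Qed.

Lemma partitionU P Q S I : partition P S -> partition Q I -> [disjoint S & I] ->
  partition (P :|: Q) (S :|: I).
Proof.
move=> pP pQ dis; apply: partition_intro.
- by move=> B /setUP[/(partition_neq0 pP)|/(partition_neq0 pQ)].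
- by move=> B /setUP[/(partitionS pP)|/(partitionS pQ)] BS;
    apply: subset_trans BS _; rewrite ?subsetUl ?subsetUr.
- by move=> x /setUP[/(partition_cover pP)|/(partition_cover pQ)] [B BP xB];
    exists B => //; rewrite inE BP ?orbT.
move=> B C x /setUP[BP|BP] /setUP[CP|CP] xB xC;
  try exact: (partition_eq (P := P) (S := S)) xB xC;
  try exact: (partition_eq (P := Q) (S := I)) xB xC;
  have := disjointFr dis (subsetP (partitionS pP _) x _).
- by move=> /(_ _ BP xB); rewrite (subsetP (partitionS pQ CP)).
- by move=> /(_ _ CP xC); rewrite (subsetP (partitionS pQ BP)).
Qed.

Definition saturated P I := [forall V in P, (V \subset I) || [disjoint V & I]].

Lemma saturatedP P I :
  reflect (forall V x y, V \in P -> x \in V -> y \in V -> x \in I -> y \in I)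
          (saturated P I).
Proof.
apply: (iffP forall_inP) => [h V x y VP xV yV xI|h V VP].
  have /orP[/subsetP->//|dis] := h V VP.
  by rewrite (disjointFr dis xV) in xI.
case: (boolP [disjoint V & I]) => [|/pred0Pn[x /andP[/= xV xI]]].
  by rewrite orbT.
by rewrite orbF; apply/subsetP => y yV; apply: (h V x).
Qed.

Definition below (T' : finType) (p : T' -> T) (P' : {set {set T'}}) P :=
  [forall B in P', exists W in P, p @: (B : {set T'}) \subset W].

Definition blocks_in P I := [set B in P | B \subset I].

Lemma blocks_in_partition P S I :
  partition P S -> saturated P I -> I \subset S -> partition (blocks_in P I) I.
Proof.
move=> pP /saturatedP sat IS; apply: partition_intro => [B|B|x xI|B C x].
- by rewrite inE => /andP[/(partition_neq0 pP)].
- by rewrite inE => /andP[].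
- have [B BP xB] := partition_cover pP (subsetP IS x xI); exists B => //.
  by rewrite inE BP; apply/subsetP => y yB; apply: (sat B x).
by rewrite !inE => /andP[BP _] /andP[CP _]; apply: (partition_eq pP).
Qed.

Lemma saturatedC P S I : partition P S -> saturated P I -> saturated P (S :\: I).
Proof.
move=> pP /saturatedP sat; apply/saturatedP => V x y VP xV yV.
rewrite !inE (subsetP (partitionS pP VP) y yV) => /andP[xI _]; rewrite andbT.
by apply: contra xI; apply: (sat V).
Qed.

Lemma blocks_inU P S I :
  partition P S -> saturated P I -> I \subset S ->
  blocks_in P I :|: blocks_in P (S :\: I) = P.
Proof.
move=> pP sat IS; apply/setP => B; rewrite !inE.
case BP: (B \in P) => //=; apply/orP.
have /forall_inP/(_ B BP)/orP[BI|dis] := sat; first by left.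
by right; rewrite subsetD (partitionS pP BP).
Qed.

Lemma blocks_inUl P1 P2 I J : partition P1 I -> partition P2 J -> [disjoint I & J] ->
  blocks_in (P1 :|: P2) I = P1.
Proof.
move=> p1 p2 dis; apply/setP => B; rewrite !inE.
have [B1|_] /= := boolP (B \in P1); first exact: partitionS p1 B1.
apply/negP => /andP[B2 BI]; have [x xB] := partition_block p2 B2.
have := disjointFr dis (subsetP BI x xB).
by rewrite (subsetP (partitionS p2 B2)).
Qed.

Lemma saturatedU P1 P2 I J : partition P1 I -> partition P2 J -> [disjoint I & J] ->
  saturated (P1 :|: P2) I.
Proof.
move=> p1 p2 dis; apply/forall_inP => V /setUP[V1|V2].
  by rewrite (partitionS p1 V1).
by rewrite disjoint_sym (disjointWr (partitionS p2 V2)) ?orbT.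
Qed.

(** A partition that saturates I is the same as a pair of partitions of I and of its
    complement in S, and the weight is multiplicative over this splitting. The condition c
    is kept abstract: it is used below with non-crossing conditions that split only
    together with other constraints. *)
Lemma sum_saturated (K : fieldType) (w : {set T} -> K) (I S : {set T})
    (c c1 c2 : pred {set {set T}}) : I \subset S ->
  (forall P1 P2, partition P1 I -> partition P2 (S :\: I) ->
     c (P1 :|: P2) = c1 P1 && c2 P2) ->
  \sum_(P | [&& partition P S, saturated P I & c P]) \prod_(V in P) w V =
  (\sum_(P | partition P I && c1 P) \prod_(V in P) w V) *
  (\sum_(P | partition P (S :\: I) && c2 P) \prod_(V in P) w V).
Proof.
move=> IS cE; rewrite big_distrlr pair_big_dep /=.
have dis : [disjoint I & S :\: I].
  by rewrite -setI_eq0; apply/eqP/setP => x; rewrite !inE; case: (x \in I).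
have SE : I :|: (S :\: I) = S by have := setID S I; rewrite (setIidPr IS).
rewrite (reindex_onto (fun q : {set {set T}} * {set {set T}} => q.1 :|: q.2)
  (fun P => (blocks_in P I, blocks_in P (S :\: I)))) /=; last first.
  by move=> P /and3P[pP sat _]; apply: blocks_inU.
have key (P1 P2 : {set {set T}}) :
    [&& partition (P1 :|: P2) S, saturated (P1 :|: P2) I & c (P1 :|: P2)]
      && ((blocks_in (P1 :|: P2) I, blocks_in (P1 :|: P2) (S :\: I)) == (P1, P2)) =
    (partition P1 I && c1 P1) && (partition P2 (S :\: I) && c2 P2).
  apply/idP/idP.
    move=> /andP[/and3P[pP sat cP]] /eqP[e1 e2].
    have p1 : partition P1 I by rewrite -e1; apply: (blocks_in_partition pP).
    have p2 : partition P2 (S :\: I).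
      rewrite -e2; apply: (blocks_in_partition pP) (saturatedC pP sat) _.
      exact: subsetDl.
    by rewrite p1 p2 /= -cE.
  move=> /andP[/andP[p1 c1P] /andP[p2 c2P]].
  rewrite (cE _ _ p1 p2) c1P c2P (saturatedU p1 p2 dis) (blocks_inUl p1 p2 dis) andbT.
  rewrite [X in blocks_in X (_ :\: _)]setUC (blocks_inUl p2 p1) 1?disjoint_sym // eqxx.
  by rewrite -[X in partition _ X]SE partitionU.
rewrite (eq_bigl (fun q => (partition q.1 I && c1 q.1) &&
  (partition q.2 (S :\: I) && c2 q.2))); last by case=> P1 P2; apply: key.
apply: eq_bigr => -[P1 P2] /= /andP[/andP[p1 _] /andP[p2 _]].
rewrite (eq_bigl [in [predU P1 & P2]]) => [|B]; last by rewrite !inE.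
rewrite bigU //=; apply/pred0P => B /=; apply/negP => /andP[B1 B2].
have [x xB] := partition_block p1 B1.
have := disjointFr dis (subsetP (partitionS p1 B1) x xB).
by rewrite (subsetP (partitionS p2 B2)).
Qed.

End Partitions.

(** * Non-crossing partitions and sums over them *)

Section NoncrossingPartitions.
Variables (T : finType) (pos : T -> nat).
Implicit Types (S I V W B C : {set T}) (P Q R : {set {set T}}).

Definition ncp S : {set {set {set T}}} :=
  [set P | partition P S & noncrossing pos P].

Definition ncsum (K : fieldType) (w : {set T} -> K) S : K :=
  \sum_(P in ncp S) \prod_(B in P) w B.

Lemma ncp_partition P S : P \in ncp S -> partition P S.
Proof. by rewrite inE => /andP[]. Qed.

Lemma ncp_noncrossing P S : P \in ncp S -> noncrossing pos P.
Proof. by rewrite inE => /andP[]. Qed.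

Lemma noncrossingS P Q : P \subset Q -> noncrossing pos Q -> noncrossing pos P.
Proof.
move=> /subsetP PQ /noncrossingP nc; apply/noncrossingP => V W VP WP.
by apply: nc; apply: PQ.
Qed.

Lemma noncrossing1 V : noncrossing pos [set V].
Proof. by apply/noncrossingP => B C /set1P-> /set1P->. Qed.

Lemma ncp1 S : S != set0 -> [set S] \in ncp S.
Proof.
move=> S0; rewrite inE noncrossing1 andbT.
by rewrite /partition cover1 eqxx trivIset1 inE eq_sym.
Qed.

Lemma ncp_neq1 P S B : P \in ncp S -> P != [set S] -> B \in P -> B \proper S.
Proof.
move=> /ncp_partition pP ne BP; rewrite properEneq (partitionS pP BP) andbT.
apply: contraNneq ne => BS; apply/eqP/setP => C; rewrite inE -BS.
apply/idP/eqP => [CP|->//]; have [x xC] := partition_block pP CP.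
by apply: (partition_eq pP CP BP xC); rewrite BS (subsetP (partitionS pP CP)).
Qed.

Lemma ncsum0 (K : fieldType) (w : {set T} -> K) : ncsum w set0 = 1.
Proof.
rewrite /ncsum (big_pred1 set0) ?big_set0 // => P.
rewrite inE partition_set0 /=; case: eqP => //= ->.
by apply/noncrossingP => V W; rewrite inE.
Qed.

(** Moments determine cumulants: the summand of the one-block partition is isolated, and
    all others involve strictly smaller sets. *)
Lemma ncsum_inj (K : fieldType) (f g : {set T} -> K) :
  (forall S, S != set0 -> ncsum f S = ncsum g S) ->
  forall S, S != set0 -> f S = g S.
Proof.
move=> fg S; have [m] := ubnP #|S|; elim: m S => // m IH S Sm S0.
have split1 (h : {set T} -> K) : ncsum h S =
    h S + \sum_(P in ncp S | P != [set S]) \prod_(B in P) h B.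
  by rewrite /ncsum (bigD1 [set S]) ?ncp1 //= big_set1.
have := fg S S0; rewrite !split1.
rewrite (eq_bigr (fun P : {set {set T}} => \prod_(B in P) g B)) => [/addIr //|].
move=> P /andP[PS ne]; apply: eq_bigr => B BP.
have prB := ncp_neq1 PS ne BP.
rewrite IH ?(partition_neq0 (ncp_partition PS) BP) //.
exact: leq_trans (proper_card prB) Sm.
Qed.

Definition order_convex S I :=
  [forall x in I, forall y in I, forall z in S,
     ((pos x < pos z) && (pos z < pos y))%N ==> (z \in I)].

Lemma order_convexP S I : reflect (forall x y z, x \in I -> y \in I -> z \in S ->
   (pos x < pos z)%N -> (pos z < pos y)%N -> z \in I) (order_convex S I).
Proof.
apply: (iffP 'forall_in_'forall_in_forall_inP) => h.
  by move=> x y z xI yI zS xz zy; have /implyP := h x xI y yI z zS; apply; rewrite xz zy.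
by move=> x xI y yI z zS; apply/implyP => /andP[xz zy]; apply: (h x y).
Qed.

(** A crossing between a block inside and a block outside of I would put an outside point
    between two points of I. *)
Lemma noncrossingU_order_convex S I P1 P2 : order_convex S I ->
  partition P1 I -> partition P2 (S :\: I) ->
  noncrossing pos (P1 :|: P2) = noncrossing pos P1 && noncrossing pos P2.
Proof.
move=> /order_convexP cvx p1 p2; apply/idP/andP => [nc|[/noncrossingP n1 /noncrossingP n2]].
  by split; apply: noncrossingS nc; rewrite ?subsetUl ?subsetUr.
have in1 V x : V \in P1 -> x \in V -> x \in I.
  by move=> VP; apply: (subsetP (partitionS p1 VP)).
have in2 V x : V \in P2 -> x \in V -> x \in S /\ x \notin I.
  by move=> VP xV; have := subsetP (partitionS p2 VP) x xV; rewrite inE => /andP[].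
apply/noncrossingP => V W /setUP[VP|VP] /setUP[WP|WP] a b c d aV bW cV dW ab bc cd.
- exact: (n1 V W VP WP a b c d).
- have [bS /negP[]] := in2 W b WP bW; apply: (cvx a c) => //; exact: (in1 V).
- have [cS /negP[]] := in2 V c VP cV; apply: (cvx b d) => //; exact: (in1 W).
- exact: (n2 V W VP WP a b c d).
Qed.

End NoncrossingPartitions.

(** * Centring by label classes *)

Section Centred.
Variables (T : eqType) (K : fieldType) (l : T -> nat) (mu : nat -> seq T -> K).

Definition with_label j (s : seq T) := [seq x <- s | l x == j].
Definition without_label j (s : seq T) := [seq x <- s | l x != j].

(** The alternating sum over the subsets J of L of the values of f at s with the classes
    in J deleted, each deleted class contributing the scalar mu. When f and mu
    are moments of free variables, this is the moment of a product of centred factors, and it still makes sense when the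
    elements of one class are not contiguous in s. *)
Fixpoint centred (W : lmodType K) (f : seq T -> W) (L : seq nat) (s : seq T) : W :=
  if L is j :: L' then
    centred f L' s - mu j (with_label j s) *: centred f L' (without_label j s)
  else f s.

Lemma with_label_without j k s : k != j ->
  with_label j (without_label k s) = with_label j s.
Proof.
move=> kj; rewrite /with_label -filter_predI; apply: eq_filter => x /=.
by case: eqP => // ->; rewrite eq_sym kj.
Qed.

Lemma without_labelC j k s :
  without_label j (without_label k s) = without_label k (without_label j s).
Proof.
by rewrite /without_label -!filter_predI; apply: eq_filter => x /=; rewrite andbC.
Qed.

(** Distinct classes are deleted independently, so the last one can be treated first;
    this is what right operators need. *)
Lemma centred_rcons (W : lmodType K) (f : seq T -> W) L j s : j \notin L ->
  centred f (rcons L j) s =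
    centred f L s - mu j (with_label j s) *: centred f L (without_label j s).
Proof.
elim: L s => //= k L IH s; rewrite inE negb_or => /andP[jk jL].
rewrite !IH // without_labelC (with_label_without _ jk) with_label_without 1?eq_sym //.
by rewrite !scalerBr !scalerA !opprD !opprK addrACA [mu k _ * _]mulrC.
Qed.

Lemma eq_centred (W : lmodType K) (f g : seq T -> W) L : f =1 g ->
  centred f L =1 centred g L.
Proof. by move=> fg; elim: L => //= j L IH s; rewrite !IH. Qed.

Lemma centred_linear (W W' : lmodType K) (h : {linear W -> W'}) f L s :
  h (centred f L s) = centred (fun t => h (f t)) L s.
Proof. by elim: L s => //= j L IH s; rewrite linearB linearZ !IH. Qed.

Lemma centred_cons (W : lmodType K) (f : seq T -> W) L x s : l x \notin L ->
  centred f L (x :: s) = centred (fun t => f (x :: t)) L s.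
Proof.
elim: L s => //= j L IH s; rewrite inE negb_or => /andP[xj xL].
by rewrite (negPf xj) !IH.
Qed.

End Centred.

Section Labels.
Variables (T : finType) (pos l : T -> nat).
Implicit Types (S I V W B C : {set T}) (P Q R : {set {set T}}).

Definition monotone_on S := [forall x in S, forall y in S, (l x < l y)%N ==> (pos x < pos y)%N].

Lemma monotone_onP S : reflect
  (forall x y, x \in S -> y \in S -> (l x < l y)%N -> (pos x < pos y)%N) (monotone_on S).
Proof.
apply: (iffP 'forall_in_forall_inP) => h x.
  by move=> y xS yS; move/implyP: (h x xS y yS).
by move=> xS y yS; apply/implyP; apply: h.
Qed.

Definition label_class j : {set T} := [set x | l x == j].

Definition parity_blocks P :=
  [forall B in P, forall x in B, forall y in B, odd (l x) == odd (l y)].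

(** If no class were saturated, there would be pairs of points of one block with distinct
    labels; take such a pair at minimal label distance. Its labels differ by at least two by parity, so there is a label in between;
    if the class of that label were linked to another class, the link would be enclosed by
    the pair, since crossings are excluded, hence would be shorter. *)
Lemma parity_saturated P S a b z : monotone_on S -> P \in ncp pos S ->
  parity_blocks P -> z \in S -> (forall x, x \in S -> (a <= l x < b)%N) ->
  exists2 j, (a <= j < b)%N & saturated P (label_class j).
Proof.
move=> /monotone_onP mono PS par zS bnd; have pP := ncp_partition PS.
have /noncrossingP nc := ncp_noncrossing PS.
have parE B x y : B \in P -> x \in B -> y \in B -> odd (l x) = odd (l y).
  by move=> BP xB yB; have /forall_inP/(_ B BP)/forall_inP/(_ x xB)/forall_inP/(_ y yB)/eqP := par.
have inS B x : B \in P -> x \in B -> x \in S.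
  by move=> BP; apply: (subsetP (partitionS pP BP)).
suff: has (fun j => saturated P (label_class j)) (iota a (b - a)).
  move=> /hasP[j]; rewrite mem_iota => /andP[aj jb] sat; exists j => //.
  rewrite aj; move: jb; rewrite addnC subnK //.
  have /andP[az zb] := bnd z zS; exact: leq_trans az (ltnW zb).
apply: contraT => /hasPn nsat.
have escape j : (a <= j < b)%N -> exists B u v,
    [/\ B \in P, u \in B, v \in B, l u = j & l v != j].
  move=> /andP[aj jb]; have /nsat/forall_inPn[B BP] : j \in iota a (b - a).
    by rewrite mem_iota aj addnC subnK // (leq_trans aj (ltnW jb)).
  rewrite negb_or => /andP[/subsetPn[v vB vl]].
  move=> /pred0Pn[u /andP[/= uB ul]]; exists B, u, v; split => //.
    by move: ul; rewrite inE => /eqP.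
  by move: vl; rewrite inE.
(* Links between distinct labels are excluded by induction on their distance. *)
suff H d B x y : B \in P -> x \in B -> y \in B -> (l x < l y)%N -> (l y - l x <= d)%N -> False.
  have [B [u [v [BP uB vB ue vne]]]] := escape _ (bnd z zS).
  have : l u != l v by rewrite ue eq_sym.
  rewrite neq_ltn => /orP[lt|lt]; exfalso.
    exact: (H _ B u v BP uB vB lt (leqnn _)).
  exact: (H _ B v u BP vB uB lt (leqnn _)).
elim: d B x y => [|d IH] B x y BP xB yB xy dist.
  by move: dist; rewrite leqn0 subn_eq0 leqNgt xy.
have xS := inS B x BP xB; have yS := inS B y BP yB.
have xy2 : ((l x).+1 < l y)%N.
  rewrite ltn_neqAle xy andbT; apply/eqP => e.
  by have := parE B x y BP xB yB; rewrite -e /=; case: odd.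
have jab : (a <= (l x).+1 < b)%N.
  have /andP[ax _] := bnd x xS; have /andP[_ yb] := bnd y yS.
  by rewrite (leqW ax) (ltn_trans xy2).
have [C [u [v [CP uC vC ul vl]]]] := escape _ jab.
have uS := inS C u CP uC; have vS := inS C v CP vC.
have BC : B != C.
  apply/eqP => BC; rewrite -BC in uC; have := parE B x u BP xB uC.
  by rewrite ul /=; case: odd.
have vpar : odd (l v) = ~~ odd (l x) by rewrite -(parE C u v CP uC vC) ul.
have xu : (pos x < pos u)%N by apply: mono => //; rewrite ul.
have uy : (pos u < pos y)%N by apply: mono => //; rewrite ul.
have xv : (l x <= l v)%N.
  rewrite leqNgt; apply/negP => vx; case/eqP: BC.
  by apply/esym; apply: (nc C B CP BP v x u y) => //; apply: mono.
have vy : (l v <= l y)%N.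
  rewrite leqNgt; apply/negP => yv; case/eqP: BC.
  by apply: (nc B C BP CP x u y v) => //; apply: mono.
apply: (IH C u v CP uC vC).
  rewrite ul ltn_neqAle eq_sym vl /= ltn_neqAle xv andbT.
  by apply/eqP => e; move: vpar; rewrite -e; case: odd.
by rewrite ul leq_subLR addSnnS -leq_subLR (leq_trans _ dist) // leq_sub2r.
Qed.
End Labels.

(** * Centred sums over non-crossing partitions vanish *)

Section CentredSums.
Variables (T : finType) (pos l : T -> nat) (K : fieldType) (w : {set T} -> K).
Implicit Types (S I V W B C : {set T}) (P Q R : {set {set T}}).

Local Notation cls := (label_class l).

Lemma monotone_convex S j : monotone_on pos l S -> order_convex pos S (S :&: cls j).
Proof.
move=> /monotone_onP mono; apply/order_convexP => x y z; rewrite !inE.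
move=> /andP[xS /eqP xj] /andP[yS /eqP yj] zS xz zy; rewrite zS /= eqn_leq.
apply/andP; split; rewrite leqNgt; apply/negP => lt.
  by have := mono y z yS zS; rewrite yj lt ltnNge (ltnW zy) => /(_ isT).
by have := mono z x zS xS; rewrite xj lt ltnNge (ltnW xz) => /(_ isT).
Qed.

Lemma monotone_onS S I : I \subset S -> monotone_on pos l S -> monotone_on pos l I.
Proof.
move=> /subsetP IS /monotone_onP mono; apply/monotone_onP => x y xI yI.
by apply: mono; apply: IS.
Qed.

Lemma saturated_setI P S I : partition P S -> saturated P (S :&: I) = saturated P I.
Proof.
move=> pP; apply: eq_forallb => B; case BP: (B \in P) => //=.
rewrite subsetI (partitionS pP BP) /=; congr (_ || _).
by rewrite -!setI_eq0 setIA (setIidPl (partitionS pP BP)).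
Qed.

Definition unsaturated (L : seq nat) P := all (fun j => ~~ saturated P (cls j)) L.

Lemma unsaturatedU L j S P1 P2 : j \notin L ->
  partition P1 (S :&: cls j) -> partition P2 (S :\: (S :&: cls j)) ->
  unsaturated L (P1 :|: P2) = unsaturated L P2.
Proof.
move=> jL p1 p2; apply: eq_in_all => k kL; congr (~~ _).
have dis B : B \in P1 -> [disjoint B & cls k].
  move=> /(partitionS p1)/subsetP sB; apply/pred0P => x /=; apply/negP.
  move=> /andP[/sB]; rewrite !inE => /andP[_ /eqP-> /eqP jk].
  by rewrite jk kL in jL.
apply/forall_inP/forall_inP => sat B; first by move=> B2; apply: sat; rewrite inE B2 orbT.
by move=> /setUP[/dis->|/sat//]; rewrite orbT.
Qed.

Definition unsaturated_sum L S :=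
  \sum_(P in ncp pos S | unsaturated L P) \prod_(B in P) w B.

(** Inclusion-exclusion, one label at a time: the partitions saturating a class are those
    counted by the product. *)
Lemma unsaturated_sum_cons j L S : monotone_on pos l S -> j \notin L ->
  unsaturated_sum (j :: L) S =
  unsaturated_sum L S - ncsum pos w (S :&: cls j) * unsaturated_sum L (S :\: cls j).
Proof.
move=> mono jL; apply/eqP; rewrite eq_sym subr_eq; apply/eqP.
rewrite {1}/unsaturated_sum (bigID (fun P => saturated P (cls j))) /= addrC.
congr (_ + _).
  by apply: eq_bigl => P /=; rewrite andbA andbAC.
have IS : S :&: cls j \subset S by apply: subsetIl.
have SD : S :\: cls j = S :\: (S :&: cls j) by rewrite setDIr setDv set0U.
rewrite /ncsum /unsaturated_sum SD.
under [X in _ = X * _]eq_bigl => P do rewrite inE.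
under [X in _ = _ * X]eq_bigl => P do rewrite inE -andbA.
rewrite -(sum_saturated w (c := fun P => noncrossing pos P && unsaturated L P) IS); last first.
  move=> P1 P2 p1 p2; rewrite (noncrossingU_order_convex (monotone_convex j mono)) //.
  by rewrite (unsaturatedU jL p1 p2) andbA.
apply: eq_bigl => P; rewrite inE; case pP: (partition P S) => //=.
by rewrite (saturated_setI _ pP) [RHS]andbC.
Qed.

Lemma centred_ncsum (L : seq nat) (s : seq T) : uniq L ->
  monotone_on pos l [set x in s] ->
  centred l (fun _ t => ncsum pos w [set x in t])
    (fun t => ncsum pos w [set x in t] : K^o) L s = unsaturated_sum L [set x in s].
Proof.
elim: L s => [|j L IH] s /=.
  by move=> _ _; apply: eq_bigl => P; rewrite andbT.
move=> /andP[jL uL] mono; rewrite unsaturated_sum_cons //.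
have e1 : [set x in with_label l j s] = [set x in s] :&: cls j.
  by apply/setP => x; rewrite !inE mem_filter andbC.
have e2 : [set x in without_label l j s] = [set x in s] :\: cls j.
  by apply/setP => x; rewrite !inE mem_filter.
by rewrite !IH ?e1 ?e2 // (monotone_onS _ mono) // subsetDl.
Qed.

(** After centring, only partitions saturating none of the classes remain, and a
    parity-respecting one among these cannot exist. *)
Lemma centred_ncsum0 (s : seq T) a b z : monotone_on pos l [set x in s] ->
  (forall B x y, B \subset [set x in s] -> x \in B -> y \in B ->
     odd (l x) != odd (l y) -> w B = 0) ->
  z \in s -> (forall x, x \in s -> (a <= l x < b)%N) ->
  centred l (fun _ t => ncsum pos w [set x in t])
    (fun t => ncsum pos w [set x in t] : K^o) (iota a (b - a)) s = 0.
Proof.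
move=> mono w0 zs bnd; rewrite centred_ncsum ?iota_uniq //.
apply: big1 => P /andP[PS uns].
have [par|/forall_inPn[B BP]] := boolP (parity_blocks l P).
  have [||j ajb sat] := parity_saturated (z := z) (a := a) (b := b) mono PS par.
  - by rewrite inE.
  - by move=> x; rewrite inE; apply: bnd.
  move: uns => /allP/(_ j); rewrite sat mem_iota => /(_ _)/negP[] //.
  have /andP[aj jb] := ajb.
  by rewrite aj addnC subnK // (leq_trans aj (ltnW jb)).
move=> /forall_inPn[x xB /forall_inPn[y yB ne]].
by rewrite (bigD1 B) //= (w0 B x y) ?mul0r ?(partitionS (ncp_partition PS)).
Qed.

(** Centring with respect to nonempty proper classes expresses the value at s by values at
    shorter lists, so it can serve as a recursion. *)
Lemma centred_determines (f g : seq T -> K) (L : seq nat) (s : seq T) : uniq L ->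
  (forall t, subseq t s -> (size t < size s)%N -> f t = g t) ->
  (forall j, j \in L -> exists2 x, x \in s & l x = j) ->
  (forall j, j \in L -> exists2 x, x \in s & l x != j) ->
  centred l (fun _ => f) (f : seq T -> K^o) L s - f s =
  centred l (fun _ => g) (g : seq T -> K^o) L s - g s.
Proof.
move=> uL fg; have szf (a : pred T) x t : x \in t -> ~~ a x -> (size (filter a t) < size t)%N.
  move=> xt ax; rewrite size_filter ltnNge; apply/negP => le.
  have : all a t by rewrite all_count eqn_leq count_size le.
  by move/allP/(_ x xt); rewrite (negPf ax).
elim: L uL => [_|j L IH /= /andP[jL uL]] ex1 ex2; first by rewrite /= !subrr.
rewrite addrAC IH //; last 2 first.
- by move=> k kL; apply: ex1; rewrite inE kL orbT.
- by move=> k kL; apply: ex2; rewrite inE kL orbT.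
have [x xs xj] := ex1 j (mem_head _ _); have [y ys yj] := ex2 j (mem_head _ _).
have l1 : (size (with_label l j s) < size s)%N by apply: szf ys _.
have l2 : (size (without_label l j s) < size s)%N by apply: szf xs _; rewrite xj eqxx.
rewrite fg ?filter_subseq // [RHS]addrAC; congr (_ - _ *: _).
have s2 : subseq (without_label l j s) s by apply: filter_subseq.
elim: (L) (without_label l j s) l2 s2 => [t ts st|k L' IH' t ts st] /=.
  exact: fg.
have le a : (size (filter a t) < size s)%N.
  by apply: leq_ltn_trans ts; rewrite size_filter count_size.
have sub a : subseq (filter a t) s by apply: subseq_trans (filter_subseq _ _) st.
by rewrite (IH' _ ts st) (IH' (without_label l k t) (le _) (sub _))
  (fg (with_label l k t) (sub _) (le _)).
Qed.

End CentredSums.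

(** * Centred words acting on the vacuum of a free product *)

Section CentredModel.
Variables (K : fieldType) (X : bool -> svspace K).
Variables (l r : forall d, {poly K} -> {linear X d -> X d}).
Variables (T : eqType) (chi : T -> face) (lab : T -> nat).

Definition face_op d (c : face) : {linear X d -> X d} :=
  if c == lft then l d 'X else r d 'X.

Definition face_vec d (s : seq T) : X d :=
  foldr (fun x v => face_op d (chi x) v) sv_xi s.

Definition face_moment j (s : seq T) : K := sv_coef (face_vec (odd j) s).

Definition model_vec (s : seq T) : free_product X :=
  model_word l r [seq (odd (lab x), chi x) | x <- s] sv_xi.

Definition centred_letters (L : seq nat) (s : seq T) : seq (letter X) :=
  [seq mkletter (sv_proj (face_vec (odd j) (with_label lab j s))) | j <- L].

(** The list s is read in the order of multiplication. A left factor acts on the beginning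
    and a right factor on the end of a word, so each left factor must come, in position,
    before all the factors that act earlier than it, and each right factor after them;
    this is the order given by s_chi. *)
Definition chi_sorted (pos : T -> nat) (s : seq T) : bool :=
  pairwise (fun x y => if chi x == lft then pos x <= pos y else pos y <= pos x)%N s.

Lemma alternating_odd_iota a m : alternating (map odd (iota a m)).
Proof.
rewrite /alternating; case: m => //= m; elim: m a => //= m IH a.
by have /= -> := IH a.+1; rewrite andbT; case: odd.
Qed.

Lemma centred_letters_tags L s : tags (centred_letters L s) = map odd L.
Proof. by rewrite /tags -map_comp. Qed.

Lemma centred_letters_without L j s : j \notin L ->
  centred_letters L (without_label lab j s) = centred_letters L s.
Proof.
move=> jL; apply/eq_in_map => k kL; rewrite with_label_without //.
by apply: contraNneq jL => ->.
Qed.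

Lemma centred_letters_cons L x s : lab x \notin L ->
  centred_letters L (x :: s) = centred_letters L s.
Proof.
move=> xL; apply/eq_in_map => k kL; rewrite /with_label /= ifN //.
by apply: contraNneq xL => ->.
Qed.

(** Both sides are images under V of elementary tensors, and lambda is conjugation by V. *)
Lemma lambda_Vd d (T1 : {linear X d -> X d}) (v : X d) s : admissible (not_first d) s ->
  lambda T1 (sv_coef v *: pure fp_all s + pure fp_all (mkletter (sv_proj v) :: s)) =
  sv_coef (T1 v) *: pure fp_all s + pure fp_all (mkletter (sv_proj (T1 v)) :: s).
Proof.
move=> ok; rewrite -Vd_pure // -[RHS]Vd_pure //.
transitivity (Vd X d (tensor_map T1 idfun (Vd_inv X d (Vd X d (tens v (pure (not_first d) s)))))).
  by [].
rewrite (VdK (tens v (pure (not_first d) s))); congr (Vd X d _).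
exact: (tensor_mapE T1 idfun).
Qed.

Lemma rho_Wd d (T1 : {linear X d -> X d}) (v : X d) s : admissible (not_last d) s ->
  rho T1 (sv_coef v *: pure fp_all s + pure fp_all (rcons s (mkletter (sv_proj v)))) =
  sv_coef (T1 v) *: pure fp_all s + pure fp_all (rcons s (mkletter (sv_proj (T1 v)))).
Proof.
move=> ok; rewrite -Wd_pure // -[RHS]Wd_pure //.
transitivity (Wd X d (tensor_map idfun T1 (Wd_inv X d (Wd X d (tens (pure (not_last d) s) v))))).
  by [].
rewrite (WdK (tens (pure (not_last d) s) v)); congr (Wd X d _).
exact: (tensor_mapE idfun T1).
Qed.

Lemma model_vec_cons x s : model_vec (x :: s) =
  (if chi x == lft then lambda (l (odd (lab x)) 'X) else rho (r (odd (lab x)) 'X))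
    (model_vec s).
Proof. by []. Qed.

Lemma with_label_missing j s : j \notin map lab s -> with_label lab j s = [::].
Proof.
move=> js; apply/eqP; rewrite -size_eq0 size_filter -leqn0 leqNgt -has_count.
by apply: contra js => /hasP[x xs /eqP<-]; apply: map_f.
Qed.

Lemma without_label_missing j s : j \notin map lab s -> without_label lab j s = s.
Proof.
move=> js; apply/all_filterP/allP => x xs.
by apply: contra js => /eqP<-; apply: map_f.
Qed.

Lemma centred_missing_first (f : seq T -> free_product X) L j s :
  j \notin map lab s -> centred lab face_moment f (j :: L) s = 0.
Proof.
move=> js /=; rewrite with_label_missing // without_label_missing //.
by rewrite /face_moment /= sv_coef_xi scale1r subrr.
Qed.

Lemma centred_missing_last (f : seq T -> free_product X) L j s : j \notin L ->
  j \notin map lab s -> centred lab face_moment f (rcons L j) s = 0.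
Proof.
move=> jL js; rewrite centred_rcons // with_label_missing // without_label_missing //.
by rewrite /face_moment /= sv_coef_xi scale1r subrr.
Qed.

(** A missing class stands for the empty product, whose value on the vacuum has no
    component in the kernel. *)
Lemma pure_centred_missing j L s : j \in L -> j \notin map lab s ->
  pure fp_all (centred_letters L s) = 0.
Proof.
move=> /splitPr[L1 L2] js; rewrite /centred_letters map_cat /= with_label_missing //.
by rewrite /= sv_proj_xi letterwise0 //; apply: pure_linear.
Qed.

(** The analogue of the product of centred free elements acting on the vacuum, by induction
    on the length. A new left factor either opens a class in front, and is then a letter put
    in front of a word of the other copy, or it acts on the first letter; both are the same
    computation through V, with the class empty in the first case. Right factors act in the
    same way on the last letter. When a class is empty in the range of labels both sides
    vanish. *)
Theorem centred_model a m s : chi_sorted lab s ->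
  all (fun x => a <= lab x < a + m)%N s ->
  centred lab face_moment model_vec (iota a m) s =
  pure fp_all (centred_letters (iota a m) s).
Proof.
have [N] := ubnP (size s); elim: N s a m => // N IH [|x s] a m /= sN.
  move=> _ _; case: m => [//|m].
  rewrite centred_missing_first // (@pure_centred_missing a) //.
  exact: mem_head.
move=> /andP[xs srt] /andP[/andP[ax xm] bnd].
have IHs t a' m' : subseq t s -> all (fun x => a' <= lab x < a' + m')%N t ->
    centred lab face_moment model_vec (iota a' m') t =
    pure fp_all (centred_letters (iota a' m') t).
  move=> ts; apply: IH; first exact: leq_ltn_trans (size_subseq ts) sN.
  by move: srt; apply: subseq_pairwise.
case: m xm bnd => [|m] xm bnd; first by rewrite addn0 ltnNge ax in xm.
set L := iota a m.+1.
have [cx|cx] := boolP (chi x == lft); last first.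
  rewrite (negPf cx) in xs.
  have LE : L = rcons (iota a m) (a + m)%N by rewrite -cats1 -[L]/(iota a m.+1) -addn1 iotaD.
  have amL : (a + m)%N \notin iota a m by rewrite mem_iota ltnn andbF.
  have [xam|xam] := eqVneq (lab x) (a + m)%N; last first.
    have lt y : y \in x :: s -> (lab y < a + m)%N.
      have xlt : (lab x < a + m)%N by rewrite ltn_neqAle xam -ltnS -addnS.
      rewrite inE => /orP[/eqP->//|ys].
      exact: leq_ltn_trans (allP xs y ys) xlt.
    have mis : (a + m)%N \notin map lab (x :: s).
      by apply/negP => /mapP[y /lt + e]; rewrite -e ltnn.
    rewrite LE centred_missing_last // (pure_centred_missing (j := (a + m)%N)) //.
    by rewrite mem_rcons mem_head.
  (* The induction hypothesis is used for s and for s with the last class deleted; together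
     they give the value for s with only the other classes centred. *)
  set s1 := without_label lab (a + m)%N s.
  set v := face_vec (odd (a + m)) (with_label lab (a + m)%N s).
  pose rest := centred_letters (iota a m) s.
  have IH1 : centred lab face_moment model_vec (iota a m) s1 = pure fp_all rest.
    rewrite IHs ?filter_subseq ?centred_letters_without //.
    apply/allP => y; rewrite mem_filter => /andP[ne ys].
    have /andP[-> /=] := allP bnd y ys.
    by rewrite addnS ltnS ltn_neqAle ne.
  have IH2 := IHs s a m.+1 (subseq_refl s) bnd.
  have lettersE t : centred_letters L t = rcons (centred_letters (iota a m) t)
      (mkletter (sv_proj (face_vec (odd (a + m)) (with_label lab (a + m)%N t)))).
    by rewrite LE /centred_letters map_rcons.
  rewrite -/L lettersE -/rest -/v LE centred_rcons // -/s1 -/v IH1 in IH2.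
  move/eqP: IH2; rewrite subr_eq addrC => /eqP IH2.
  rewrite LE centred_rcons //= /without_label /= xam eqxx /= -/s1 IH1.
  rewrite centred_cons ?xam //.
  rewrite (eq_centred _ _ (g := fun t => rho (r (odd (a + m)) 'X) (model_vec t))); last first.
    by move=> t; rewrite model_vec_cons (negPf cx) xam.
  rewrite -(centred_linear lab face_moment (rho (r (odd (a + m)) 'X))) IH2 rho_Wd; last first.
    rewrite /admissible centred_letters_tags alternating_odd_iota /not_last.
    rewrite -map_rev; case: (m) => [//|k]; rewrite -[k.+1]addn1 iotaD /= rev_cat /=.
    rewrite addn1 addnS /= (inj_eq Some_inj); by case: odd.
  have vecE : face_vec (odd (a + m)) (with_label lab (a + m)%N (x :: s)) =
      r (odd (a + m)) 'X v.
    by rewrite /with_label /= xam eqxx /= /face_op (negPf cx).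
  rewrite -LE lettersE centred_letters_cons ?xam // vecE -/rest -/v.
  have -> : face_moment (a + m) (x :: with_label lab (a + m)%N s) =
      sv_coef (r (odd (a + m)) 'X v) by rewrite /face_moment /= /face_op (negPf cx).
  by rewrite addrAC subrr add0r.
rewrite cx in xs.
have LE : L = a :: iota a.+1 m by [].
have aL : a \notin iota a.+1 m by rewrite mem_iota ltnn.
have [xa|xa] := eqVneq (lab x) a; last first.
  have lt y : y \in x :: s -> (a < lab y)%N.
    have xlt : (a < lab x)%N by rewrite ltn_neqAle eq_sym xa.
    rewrite inE => /orP[/eqP->//|ys].
    exact: leq_trans xlt (allP xs y ys).
  have mis : a \notin map lab (x :: s).
    by apply/negP => /mapP[y /lt + e]; rewrite -e ltnn.
  rewrite LE centred_missing_first // (pure_centred_missing (j := a)) //.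
  exact: mem_head.
set s1 := without_label lab a s.
set v := face_vec (odd a) (with_label lab a s).
pose rest := centred_letters (iota a.+1 m) s.
have IH1 : centred lab face_moment model_vec (iota a.+1 m) s1 = pure fp_all rest.
  rewrite IHs ?filter_subseq ?centred_letters_without //.
  apply/allP => y; rewrite mem_filter => /andP[ne ys].
  have /andP[ay ym] := allP bnd y ys.
  by rewrite addSnnS ym andbT ltn_neqAle eq_sym ne.
have IH2 := IHs s a m.+1 (subseq_refl s) bnd.
have lettersE t : centred_letters L t =
    mkletter (sv_proj (face_vec (odd a) (with_label lab a t))) ::
      centred_letters (iota a.+1 m) t by [].
rewrite -/L lettersE -/rest -/v LE /= -/s1 -/v IH1 in IH2.
move/eqP: IH2; rewrite subr_eq addrC => /eqP IH2.
rewrite LE /= /without_label /= xa eqxx /= -/s1 IH1 centred_cons ?xa //.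
rewrite (eq_centred _ _ (g := fun t => lambda (l (odd a) 'X) (model_vec t))); last first.
  by move=> t; rewrite model_vec_cons cx xa.
rewrite -(centred_linear lab face_moment (lambda (l (odd a) 'X))) IH2 lambda_Vd; last first.
  rewrite /admissible centred_letters_tags alternating_odd_iota /not_first.
  by case: (m) => [//|k] /=; rewrite (inj_eq Some_inj); case: odd.
rewrite centred_letters_cons ?xa // -/rest -/v.
have opE : face_op (odd a) (chi x) = l (odd a) 'X by rewrite /face_op cx.
have -> : face_moment a (x :: with_label lab a s) = sv_coef (l (odd a) 'X v).
  by rewrite /face_moment /= opE.
by rewrite opE addrAC subrr add0r.
Qed.
End CentredModel.

Section ModelMoments.
Variables (K : fieldType) (X : bool -> svspace K).
Variables (l r : forall d, {poly K} -> {linear X d -> X d}).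
Variables (T : eqType) (chi : T -> face) (lab : T -> nat).

Definition model_moment (s : seq T) : K := sv_coef (model_vec l r chi lab s).

Lemma sv_coef_pure (s : seq (letter X)) : s != [::] -> admissible fp_all s ->
  @sv_coef _ (free_product X) (pure fp_all s) = 0.
Proof.
move=> s0 ok; apply: sv_coef_uniq; rewrite scale0r /= [LHS]summands_liftE //.
by case: s s0 {ok}.
Qed.

Lemma centred_letters_admissible a m s :
  admissible fp_all (centred_letters l r chi lab (iota a m) s).
Proof. by rewrite /admissible centred_letters_tags alternating_odd_iota. Qed.

Lemma sv_coef_centred mu (L : seq nat) s :
  sv_coef (centred lab mu (model_vec l r chi lab) L s) =
  centred lab mu (model_moment : seq T -> K^o) L s.
Proof.
elim: L s => //= j L IH s.
by rewrite linearB /= linearZ /= !IH.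
Qed.

(** With a single class the theorem above compares the moment in one copy with the moment
    in the free product. *)
Lemma face_moment_model j t : chi_sorted chi lab t -> all (fun x => lab x == j) t ->
  face_moment l r chi j t = model_moment t.
Proof.
move=> srt /allP labj.
have bnd : all (fun x => j <= lab x < j + 1)%N t.
  by apply/allP => x /labj/eqP->; rewrite leqnn addn1 ltnSn.
have := congr1 (@sv_coef _ (free_product X)) (centred_model l r srt bnd).
rewrite sv_coef_pure ?centred_letters_admissible // sv_coef_centred /=.
have -> : with_label lab j t = t by apply/all_filterP/allP.
have -> : without_label lab j t = [::].
  apply/eqP; rewrite -size_eq0 size_filter -leqn0 leqNgt -has_count.
  by apply/hasPn => x /labj ->.
rewrite {2}/model_moment /= (@sv_coef_xi _ (free_product X)) => /eqP.
by rewrite /GRing.scale /= mulr1 subr_eq0 => /eqP.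
Qed.

Lemma centred_model_moment a m s : chi_sorted chi lab s ->
  all (fun x => a <= lab x < a + m.+1)%N s ->
  centred lab (fun _ => model_moment) (model_moment : seq T -> K^o) (iota a m.+1) s = 0.
Proof.
move=> srt bnd.
have := congr1 (@sv_coef _ (free_product X)) (centred_model l r srt bnd).
rewrite sv_coef_pure ?centred_letters_admissible // sv_coef_centred => <-.
elim: (iota _ _) s srt {bnd} => //= j L IH s srt.
have sub t : subseq t s -> chi_sorted chi lab t.
  by move=> /subseq_pairwise; apply.
rewrite !IH ?sub ?filter_subseq // face_moment_model ?sub ?filter_subseq //.
exact: filter_all.
Qed.

End ModelMoments.

Section Labels.
Variables (T : finType) (pos : T -> nat) (pos_inj : injective pos) (c : T -> bool).
Implicit Types S : {set T}.

(** Labels count colour changes along the order. They are built by adding the element of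
    largest position, which reuses the last label if it has the right parity. *)
Lemma colour_labels S : exists (lab : T -> nat) (a b : nat),
  [/\ monotone_on pos lab S, forall x, x \in S -> odd (lab x) = c x,
      forall x, x \in S -> (a <= lab x < b)%N
    & forall j, (a <= j < b)%N -> exists2 x, x \in S & lab x = j].
Proof.
have [n] := ubnP #|S|; elim: n S => // n IH S Sn.
have [->|[x0 x0S]] := set_0Vmem S.
  exists (fun=> 0%N), 0%N, 0%N; split=> [|x|x|j]; rewrite ?inE ?andbF //.
  by apply/monotone_onP => x y; rewrite inE.
have [x xS_ xmax] := arg_maxnP pos x0S; have xS : x \in S by [].
have lt_x y : y \in S -> y != x -> (pos y < pos x)%N.
  move=> yS yx; rewrite ltn_neqAle (inj_eq pos_inj) yx; exact: xmax.
have [|lab [a [b [/monotone_onP mono par bnd sur]]]] := IH (S :\ x).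
  by move: Sn; rewrite (cardsD1 x S) xS.
have inD y : y \in S -> y != x -> y \in S :\ x by move=> yS yx; rewrite !inE yx.
(* The element x of largest position receives the label j. *)
have build j a' b' : (forall y, y \in S :\ x -> (lab y <= j)%N) -> odd j = c x ->
    (forall y, y \in S :\ x -> (a' <= lab y < b')%N) -> (a' <= j < b')%N ->
    (forall k, (a' <= k < b')%N -> k != j -> exists2 y, y \in S :\ x & lab y = k) ->
    exists (lab : T -> nat) (a b : nat),
    [/\ monotone_on pos lab S, forall x, x \in S -> odd (lab x) = c x,
      forall x, x \in S -> (a <= lab x < b)%N
    & forall j, (a <= j < b)%N -> exists2 x, x \in S & lab x = j].
  move=> lej oj bnd' jab sur'; exists (fun y => if y == x then j else lab y), a', b'.
  split.
  - apply/monotone_onP => y z yS zS.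
    have [->|yx] := eqVneq y x.
      have [->|zx] := eqVneq z x; first by rewrite ltnn.
      by rewrite ltnNge lej // inD.
    have [->|zx] := eqVneq z x; first by move=> _; apply: lt_x.
    by apply: mono; apply: inD.
  - by move=> y yS; case: eqVneq => [->|yx] //; apply: par; apply: inD.
  - by move=> y yS; case: eqVneq => [//|yx]; apply: bnd'; apply: inD.
  move=> k kab; have [->|kj] := eqVneq k j; first by exists x; rewrite ?eqxx.
  have [y] := sur' k kab kj; rewrite !inE => /andP[yx yS] e.
  by exists y => //; rewrite (negPf yx).
have [S0|[y0 y0S]] := set_0Vmem (S :\ x).
  apply: (build (c x) (c x) (c x).+1).
  - by move=> y; rewrite S0 inE.
  - by case: (c x).
  - by move=> y; rewrite S0 inE.
  - by rewrite leqnn ltnSn.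
  by move=> k; rewrite ltnS -eqn_leq eq_sym => /eqP->; rewrite eqxx.
have /andP[ay0 y0b] := bnd y0 y0S.
have b0 : b = b.-1.+1 by rewrite (ltn_predK y0b).
have ab1 : (a <= b.-1)%N by rewrite (leq_trans ay0) // -ltnS -b0.
have [e|ne] := eqVneq (odd b.-1) (c x).
  apply: (build b.-1 a b) => //.
  - by move=> y yS; have /andP[_] := bnd y yS; rewrite {1}b0 ltnS.
  - by rewrite ab1 {2}b0 ltnSn.
  by move=> k kab _; apply: sur.
apply: (build b a b.+1).
- by move=> y yS; have /andP[_ /ltnW] := bnd y yS.
- by rewrite b0 /=; move: ne; case: odd; case: (c x).
- by move=> y yS; have /andP[-> yb] := bnd y yS; rewrite leqW.
- by rewrite ltnSn (leq_trans ab1) ?leq_pred.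
by move=> k /andP[ak kb] ne'; apply: sur; rewrite ak ltn_neqAle ne' -ltnS kb.
Qed.

End Labels.

(** * Mixed moments of a bi-free pair *)

Section MixedMoments.
Variables (K : fieldType) (A : algType K) (phi : {scalar A}) (phi1 : phi 1 = 1).
Variables (z1 z2 : two_faced A) (z12 : bifree phi z1 z2).
Variables (T : finType) (pos : T -> nat) (pos_inj : injective pos).
Variables (chi : T -> face) (c : T -> bool).

Definition mixed_moment (s : seq T) : K :=
  phi (\prod_(x <- s) (if c x then z2 else z1) (chi x)).

Lemma centred_mixed_moment lab (s : seq T) a m : chi_sorted chi lab s ->
  (forall x, x \in s -> odd (lab x) = c x) ->
  (forall x, x \in s -> (a <= lab x < a + m.+1)%N) ->
  centred lab (fun _ => mixed_moment) (mixed_moment : seq T -> K^o) (iota a m.+1) s = 0.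
Proof.
move=> srt par /allP bnd; have [X [l [r [_ _ modelE]]]] := z12.
rewrite -(centred_model_moment l r srt bnd).
have mE t : {subset t <= s} -> mixed_moment t = model_moment l r chi lab t.
  move=> ts; rewrite /mixed_moment /model_moment.
  transitivity (sv_state (model_word l r [seq (odd (lab x), chi x) | x <- t])); last by [].
  rewrite modelE big_map; congr (phi _); apply: eq_big_seq => x xt /=.
  by rewrite par ?ts.
elim: (iota _ _) s mE {srt par bnd} => [|j L IH] s mE /=; first by rewrite mE.
have sub (t : pred T) : {subset filter t s <= s}.
  by move=> x; rewrite mem_filter => /andP[].
rewrite mE; last exact: sub.
congr (_ - _ *: _); first exact: IH.
by apply: IH => t ts; apply: mE => x /ts; apply: sub.
Qed.

Variable e : seq T.
Hypotheses (e_uniq : uniq e) (e_sorted : chi_sorted chi pos e).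

Variable w : {set T} -> K.
Hypothesis w0 : forall (B : {set T}) x y, x \in B -> y \in B -> c x != c y -> w B = 0.
Hypothesis wE : forall d s, subseq s e -> s != [::] ->
  all (fun x => c x == d) s -> mixed_moment s = ncsum pos w [set x in s].

(** Moments and sums over non-crossing partitions satisfy the same centring relation for
    the labels of colour_labels, and agree when there is only one colour; with two or more
    classes the relation reduces the claim to shorter lists. *)
Theorem mixed_moment_ncsum s : subseq s e ->
  mixed_moment s = ncsum pos w [set x in s].
Proof.
have [n] := ubnP (size s); elim: n s => // n IH s sn se.
have us : uniq s by apply: subseq_uniq se e_uniq.
have srt : chi_sorted chi pos s by move: e_sorted; apply: subseq_pairwise.
have [->|s0] := eqVneq s [::].
  rewrite /mixed_moment big_nil phi1.
  have -> : [set x in [::]] = set0 :> {set T} by apply/setP => x; rewrite !inE.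
  by rewrite ncsum0.
have [lab [a [b [mono par bnd sur]]]] := colour_labels pos_inj c [set x in s].
have [x0 x0s] : exists x, x \in s by case: (s) s0 => // x t _; exists x; apply: mem_head.
have ps x : x \in s -> odd (lab x) = c x by move=> xs; apply: par; rewrite inE.
have bs x : x \in s -> (a <= lab x < b)%N by move=> xs; apply: bnd; rewrite inE.
have [/hasP[x1 x1s ne]|/hasPn one] := boolP (has (fun x => lab x != lab x0) s); last first.
  apply: (wE (d := c x0)) => //; apply/allP => x xs; rewrite -!ps //.
  by have := one x xs; rewrite negbK => /eqP->.
have srtl : chi_sorted chi lab s.
  move: srt; apply: (sub_in_pairwise (P := mem s)); last by apply/allP.
  move=> x y xs ys; move/monotone_onP: mono => mono.
  have xS : x \in [set x in s] by rewrite inE.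
  have yS : y \in [set x in s] by rewrite inE.
  case: ifP => _ le; rewrite leqNgt; apply/negP => lt.
    by have := mono y x yS xS lt; rewrite ltnNge le.
  by have := mono x y xS yS lt; rewrite ltnNge le.
have ab : (a < b)%N by have /andP[ax xb] := bs x0 x0s; apply: leq_ltn_trans xb.
have bE : b = (a + (b - a).-1.+1)%N by rewrite prednK ?subn_gt0 // subnKC // ltnW.
have baE : (b - a = (b - a).-1.+1)%N by rewrite prednK // subn_gt0.
have v1 : centred lab (fun _ => mixed_moment) (mixed_moment : seq T -> K^o) (iota a (b - a)) s = 0.
  rewrite baE; apply: centred_mixed_moment => // x xs; rewrite -bE; exact: bs.
have v2 : centred lab (fun _ t => ncsum pos w [set x in t])
    (fun t => ncsum pos w [set x in t] : K^o) (iota a (b - a)) s = 0.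
  apply: centred_ncsum0 x0s bs => // B x y /subsetP Bs xB yB odd_ne.
  have ins z : z \in B -> z \in s by move=> /Bs; rewrite inE.
  by apply: (w0 xB yB); rewrite -!ps ?ins.
have := @centred_determines T lab K mixed_moment (fun t => ncsum pos w [set x in t])
  (iota a (b - a)) s (iota_uniq _ _).
rewrite v1 v2 !sub0r => det; apply: oppr_inj; apply: det.
- move=> t ts lt; apply: IH; first exact: leq_trans lt sn.
  exact: subseq_trans ts se.
- move=> j; rewrite mem_iota baE -bE => /sur[x]; rewrite inE => xs xj; by exists x.
move=> j _; have [x0j|ne'] := eqVneq (lab x0) j; last by exists x0.
by exists x1; rewrite // -x0j.
Qed.
End MixedMoments.

(** * The finest non-crossing coarsening *)

Section Indecomposable.
Variables (T' T : finType) (pos' : T' -> nat) (pos : T -> nat) (p : T' -> T).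
Hypothesis pos_inj : injective pos.
Hypothesis p_mono : forall x y, (pos' x < pos' y)%N -> (pos (p x) <= pos (p y))%N.
Implicit Types (S V W : {set T}) (Q R : {set {set T}}) (P : {set {set T'}}).

Lemma belowP P Q : reflect
  (forall B, B \in P -> exists2 W, W \in Q & forall x, x \in B -> p x \in W)
  (below p P Q).
Proof.
apply: (iffP forall_inP) => h B BP.
  have /exists_inP[W WQ /subsetP sub] := h B BP; exists W => // x xB.
  exact/sub/imset_f.
have [W WQ sub] := h B BP; apply/exists_inP; exists W => //.
by apply/subsetP => _ /imsetP[x xB ->]; apply: sub.
Qed.

(** Seen through p, the partition P connects V: V itself is the only non-crossing partition
    of V that P refines. *)
Definition indecomposable V P :=
  [forall R in ncp pos V, below p P R ==> (R == [set V])].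

Lemma indecomposableP V P : reflect
  (forall R, R \in ncp pos V -> below p P R -> R = [set V]) (indecomposable V P).
Proof.
apply: (iffP forall_inP) => h R RV; first by move/(implyP (h R RV))/eqP.
by apply/implyP => /(h R RV)/eqP.
Qed.

(** Q is the finest non-crossing partition whose preimage is refined by P; this local form
    of the condition is what factorises over the blocks of Q. *)
Definition splits P Q :=
  below p P Q && [forall V in Q, indecomposable V (blocks_in P (p @^-1: V))].

Definition trace_on Q V : {set {set T}} := [set W :&: V | W in Q] :\ set0.

Lemma trace_on_ncp Q S V : Q \in ncp pos S -> V \subset S -> trace_on Q V \in ncp pos V.
Proof.
move=> QS /subsetP VS; have pQ := ncp_partition QS.
rewrite inE; apply/andP; split.
  apply: partition_intro => [B|B|x xV|B C x].
  - by rewrite inE => /andP[+ _]; rewrite inE.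
  - by move=> /setD1P[_ /imsetP[W _ ->]]; apply: subsetIr.
  - have [W WQ xW] := partition_cover pQ (VS x xV); exists (W :&: V).
      by rewrite in_setD1 (imset_f (fun U => U :&: V) WQ) andbT;
        apply/set0Pn; exists x; rewrite inE xW.
    by rewrite inE xW.
  move=> /setD1P[_ /imsetP[W1 W1Q ->]] /setD1P[_ /imsetP[W2 W2Q ->]].
  by move=> /setIP[x1 _] /setIP[x2 _]; rewrite (partition_eq pQ W1Q W2Q x1 x2).
apply/noncrossingP => B C /setD1P[_ /imsetP[W1 W1Q ->]] /setD1P[_ /imsetP[W2 W2Q ->]].
move=> a b c d /setIP[aW _] /setIP[bW _] /setIP[cW _] /setIP[dW _] ab bc cd.
have /noncrossingP nc := ncp_noncrossing QS.
by rewrite (nc W1 W2 W1Q W2Q a b c d).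
Qed.

(** The trace of R on a block of Q is a non-crossing partition that the corresponding part of
    P refines, so indecomposability makes this trace trivial. *)
Lemma splits_refines P S Q R : partition P (p @^-1: S) ->
  Q \in ncp pos S -> R \in ncp pos S -> splits P Q -> below p P R ->
  forall V, V \in Q -> exists2 W, W \in R & V \subset W.
Proof.
move=> pP QS RS /andP[_ /forall_inP irr] /belowP bel V VQ.
have VS := partitionS (ncp_partition QS) VQ.
have : trace_on R V = [set V].
  apply: (indecomposableP _ _ (irr V VQ)); first exact: trace_on_ncp RS VS.
  apply/belowP => B; rewrite inE => /andP[BP /subsetP BV].
  have [W WR sub] := bel B BP; exists (W :&: V); last first.
    by move=> x xB; rewrite inE sub //; have := BV x xB; rewrite inE.
  rewrite in_setD1 (imset_f (fun U => U :&: V) WR) andbT; have [x xB] := partition_block pP BP.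
  by apply/set0Pn; exists (p x); rewrite inE sub //; have := BV x xB; rewrite inE.
move/setP/(_ V); rewrite in_setD1 in_set1 eqxx => /andP[_ /imsetP[W WR e]].
by exists W => //; rewrite e subsetIl.
Qed.

Lemma splits_unique P S Q R : partition P (p @^-1: S) ->
  Q \in ncp pos S -> R \in ncp pos S -> splits P Q -> splits P R -> Q = R.
Proof.
move=> pP QS RS sQ sR.
have half Q1 Q2 : Q1 \in ncp pos S -> Q2 \in ncp pos S -> splits P Q1 -> splits P Q2 ->
    Q1 \subset Q2.
  move=> S1 S2 s1 s2; apply/subsetP => V V1.
  have b1 := (andP s1).1; have b2 := (andP s2).1.
  have [W W2 VW] := splits_refines pP S1 S2 s1 b2 V1.
  have [V' V'1 WV] := splits_refines pP S2 S1 s2 b1 W2.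
  have [x xV] := partition_block (ncp_partition S1) V1.
  have e : V = V'.
    apply: (partition_eq (ncp_partition S1) V1 V'1 xV).
    exact/(subsetP WV)/(subsetP VW).
  by have -> : V = W by apply/eqP; rewrite eqEsubset VW e.
by apply/eqP; rewrite eqEsubset !half.
Qed.

(** A partition Q with the largest number of blocks works: a nontrivial partition of one of
    its blocks V, refined by the part of P over V, could be substituted for V. *)
Lemma splits_exists P S : S != set0 -> partition P (p @^-1: S) ->
  exists2 Q, Q \in ncp pos S & splits P Q.
Proof.
move=> S0 pP.
have ok0 : ([set S] \in ncp pos S) && below p P [set S].
  rewrite ncp1 //; apply/belowP => B BP; exists S; rewrite ?inE // => x xB.
  by have := subsetP (partitionS pP BP) x xB; rewrite inE.
have [Q /andP[QS bel] Qmax] :=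
  arg_maxnP (P := fun Q => (Q \in ncp pos S) && below p P Q)
    (fun Q : {set {set T}} => #|Q|) ok0.
exists Q => //; rewrite /splits bel; apply/forall_inP => V VQ; apply/indecomposableP => R RV belR.
have pQ := ncp_partition QS; have pR := ncp_partition RV.
have VS := partitionS pQ VQ.
have dis : [disjoint S :\: V & V].
  by apply/pred0P => x /=; rewrite !inE; case: (x \in V); rewrite ?andbF.
have Q'S : ((Q :\ V) :|: R \in ncp pos S) && below p P ((Q :\ V) :|: R).
  apply/andP; split; last first.
    apply/belowP => B BP; have [W WQ sub] := belowP _ _ bel B BP.
    have [WV|WV] := eqVneq W V; last by exists W => //; rewrite !inE WV WQ.
    have [|W' W'R sub'] := belowP _ _ belR B.
      rewrite inE BP; apply/subsetP => x /sub; rewrite inE WV.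
      by [].
    by exists W' => //; rewrite inE W'R orbT.
  rewrite inE; apply/andP; split.
    have := partitionU (partitionD1 pQ VQ) pR dis.
    suff -> : S :\: V :|: V = S by [].
    by have := setID S V; rewrite (setIidPr VS) setUC.
  have /noncrossingP ncQ := ncp_noncrossing QS.
  have /noncrossingP ncR := ncp_noncrossing RV.
  have inV C x : C \in R -> x \in C -> x \in V.
    by move=> CR; apply: (subsetP (partitionS pR CR)).
  apply/noncrossingP => B C /setUP[/setD1P[BV BQ]|BR] /setUP[/setD1P[CV CQ]|CR]
    a b c d aB bC cB dC ab bc cd.
  - exact: (ncQ B C BQ CQ a b c d).
  - by case/eqP: BV; apply: (ncQ B V BQ VQ a b c d) => //; apply: (inV C).
  - by case/eqP: CV; apply/esym; apply: (ncQ V C VQ CQ a b c d) => //; apply: (inV B).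
  - exact: (ncR B C BR CR a b c d).
have := Qmax _ Q'S; rewrite cardsU.
have -> : (Q :\ V) :&: R = set0.
  apply/setP => B; rewrite !inE; apply/negP => /andP[/andP[BV BQ] BR].
  have [x xB] := partition_block pR BR; case/eqP: BV.
  by apply: (partition_eq pQ BQ VQ xB); apply: (subsetP (partitionS pR BR)).
rewrite cards0 subn0 [X in (_ <= X)%N -> _](cardsD1 V Q) VQ addnC leq_add2r => R1.
have [x xV] := partition_block pQ VQ; have [B BR xB] := partition_cover pR xV.
have RB : R = [set B].
  by apply/esym/eqP; rewrite eqEcard sub1set BR cards1.
by rewrite -(cover_partition pR) RB cover1.
Qed.

Variables (K : fieldType) (w : {set T'} -> K).

Definition indecomposable_sum V : K :=
  \sum_(P in ncp pos' (p @^-1: V) | indecomposable V P) \prod_(B in P) w B.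

(** The blocks of Q are split off one by one. Non-crossing partitions over distinct blocks of
    Q can be united without a crossing because p is monotone and Q is non-crossing. *)
Lemma sum_splits S Q : Q \in ncp pos S ->
  \sum_(P in ncp pos' (p @^-1: S) | splits P Q) \prod_(B in P) w B =
  \prod_(V in Q) indecomposable_sum V.
Proof.
have [n] := ubnP #|Q|; elim: n Q S => // n IH Q S Qn QS.
have pQ := ncp_partition QS.
have [Q0|[V VQ]] := set_0Vmem Q.
  have S0 : S = set0 by rewrite -(cover_partition pQ) Q0 /cover big_set0.
  rewrite Q0 big_set0 S0 preimset0 (big_pred1 set0) ?big_set0 // => P.
  rewrite inE partition_set0 /=; apply/andP/eqP => [[/andP[/eqP]]//|->].
  rewrite eqxx; split; first by apply/noncrossingP => B C; rewrite inE.
  by apply/andP; split; apply/forall_inP => B; rewrite inE.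
have VS := partitionS pQ VQ.
have Q1S : Q :\ V \in ncp pos (S :\: V).
  rewrite inE partitionD1 //; apply: noncrossingS (ncp_noncrossing QS); exact: subsetDl.
rewrite (bigD1 V) //=.
have -> : \prod_(W in Q | W != V) indecomposable_sum W =
    \prod_(W in Q :\ V) indecomposable_sum W.
  by apply: eq_bigl => W; rewrite !inE andbC.
rewrite -(IH _ (S :\: V)) //; last by move: Qn; rewrite (cardsD1 V Q) VQ.
have IS : p @^-1: V \subset p @^-1: S by apply: preimsetS.
have key P1 P2 : partition P1 (p @^-1: V) -> partition P2 (p @^-1: S :\: p @^-1: V) ->
  noncrossing pos' (P1 :|: P2) && splits (P1 :|: P2) Q =
  (noncrossing pos' P1 && indecomposable V P1) && (noncrossing pos' P2 && splits P2 (Q :\ V)).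
  move=> p1 p2.
  have dis : [disjoint p @^-1: V & p @^-1: S :\: p @^-1: V].
    by apply/pred0P => x /=; rewrite !inE; case: (p x \in V).
  have belE : below p (P1 :|: P2) Q = below p P2 (Q :\ V).
    apply/belowP/belowP => bel B.
      move=> B2; have [|W WQ sub] := bel B; first by rewrite inE B2 orbT.
      exists W => //; rewrite !inE WQ andbT; apply/eqP => WV.
      have [x xB] := partition_block p2 B2.
      by have := subsetP (partitionS p2 B2) x xB; rewrite !inE -WV sub.
    move=> /setUP[B1|/bel[W /setD1P[_ WQ] sub]]; last by exists W.
    exists V => // x xB; by have := subsetP (partitionS p1 B1) x xB; rewrite inE.
  have irrE : [forall W in Q, indecomposable W (blocks_in (P1 :|: P2) (p @^-1: W))] =
      indecomposable V P1 && [forall W in Q :\ V, indecomposable W (blocks_in P2 (p @^-1: W))].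
    have other W : W \in Q -> W != V ->
        blocks_in (P1 :|: P2) (p @^-1: W) = blocks_in P2 (p @^-1: W).
      move=> WQ WV; apply/setP => B; rewrite !inE; case B1: (B \in P1) => //=.
      apply/idP/andP => [/subsetP BW|[]//]; have [x xB] := partition_block p1 B1.
      have := BW x xB; have := subsetP (partitionS p1 B1) x xB; rewrite !inE => xV xW.
      by case/eqP: WV; apply: (partition_eq pQ WQ VQ xW xV).
    apply/forall_inP/andP => [irr|[irr1 /forall_inP irr2] W WQ].
      split; first by have := irr V VQ; rewrite (blocks_inUl p1 p2).
      apply/forall_inP => W /setD1P[WV WQ]; rewrite -other //; exact: irr.
    have [->|WV] := eqVneq W V; first by rewrite (blocks_inUl p1 p2).
    by rewrite other //; apply: irr2; rewrite !inE WV.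
  rewrite /splits belE irrE; case bel: (below p P2 (Q :\ V)); last by rewrite !andbF.
  rewrite !andTb.
  suff -> : noncrossing pos' (P1 :|: P2) = noncrossing pos' P1 && noncrossing pos' P2.
    by rewrite andbACA.
  apply/idP/andP => [nc|[/noncrossingP n1 /noncrossingP n2]].
    by split; apply: noncrossingS nc; rewrite ?subsetUl ?subsetUr.
  have /noncrossingP ncQ := ncp_noncrossing QS.
  have cross B C a b c d (W1 W2 : {set T}) : W1 \in Q -> W2 \in Q -> W1 != W2 ->
     p a \in W1 -> p b \in W2 -> p c \in W1 -> p d \in W2 ->
     (pos' a < pos' b)%N -> (pos' b < pos' c)%N -> (pos' c < pos' d)%N -> B = C :> {set T'}.
    move=> W1Q W2Q W12 a1 b2 c1 d2 ab bc cd; case/eqP: (W12).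
    have lt x y U1 U2 : U1 \in Q -> U2 \in Q -> U1 != U2 -> p x \in U1 -> p y \in U2 ->
        (pos' x < pos' y)%N -> (pos (p x) < pos (p y))%N.
      move=> U1Q U2Q U12 x1 y2 xy; rewrite ltn_neqAle p_mono // andbT (inj_eq pos_inj).
      apply: contraNneq U12 => e; rewrite -e in y2.
      by rewrite (partition_eq pQ U1Q U2Q x1 y2).
    by apply: (ncQ W1 W2 W1Q W2Q (p a) (p b) (p c) (p d)) => //;
      [apply: (lt a b W1 W2) | apply: (lt b c W2 W1) | apply: (lt c d W1 W2)];
      rewrite // eq_sym.
  have in1 B x : B \in P1 -> x \in B -> p x \in V.
    by move=> B1 xB; have := subsetP (partitionS p1 B1) x xB; rewrite inE.
  apply/noncrossingP => B C /setUP[B1|B2] /setUP[C1|C2] a b c d aB bC cB dC ab bc cd.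
  - exact: (n1 B C B1 C1 a b c d).
  - have [W /setD1P[WV WQ] sub] := belowP _ _ bel C C2.
    apply: (cross B C a b c d V W) => //; rewrite 1?eq_sym ?sub //; exact: (in1 B).
  - have [W /setD1P[WV WQ] sub] := belowP _ _ bel B B2.
    apply: (cross B C a b c d W V) => //; rewrite ?sub //; exact: (in1 C).
  - exact: (n2 B C B2 C2 a b c d).
have SD : p @^-1: (S :\: V) = p @^-1: S :\: p @^-1: V by rewrite preimsetD.
have prodE := sum_saturated w (c := fun P => noncrossing pos' P && splits P Q) IS key.
rewrite /indecomposable_sum SD; apply: etrans (etrans _ prodE) _; last first.
  by congr (_ * _); apply: eq_bigl => P; rewrite inE andbA.
apply: eq_bigl => P; rewrite inE -andbA.
case pP: (partition P _) => //=.
case sat: (saturated P _) => //=; apply/negP => /andP[_ /andP[/belowP bel _]].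
case/negP: sat; apply/saturatedP => B x y BP xB yB; rewrite !inE => xV.
have [W WQ sub] := bel B BP.
by rewrite (partition_eq pQ VQ WQ xV) ?sub.
Qed.

(** Partitions upstairs are sorted by the partition Q that they split along, so that their
    sum takes the form of a moment-cumulant formula downstairs. *)
Theorem ncsum_preimset S : S != set0 ->
  ncsum pos' w (p @^-1: S) = ncsum pos indecomposable_sum S.
Proof.
move=> S0; rewrite /ncsum.
under [RHS]eq_bigr => Q QS do rewrite -(sum_splits QS).
rewrite (exchange_big_dep (fun P => P \in ncp pos' (p @^-1: S))) //=; last first.
  by move=> Q P _ /andP[].
apply: eq_bigr => P PS; have pP := ncp_partition PS.
have [Q QS sQ] := splits_exists S0 pP.
rewrite (big_pred1 Q) // => R; rewrite PS /=.
apply/andP/eqP => [[RS sR]|->//]; exact: (splits_unique pP).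
Qed.

End Indecomposable.

(** * Indecomposable bicoloured partitions and Kreweras complements *)

Section Kreweras.
Variables (T : finType) (pos : T -> nat) (pos_inj : injective pos).
Implicit Types (S I U V W B C : {set T}) (P Q R pi tau : {set {set T}}).

Definition half_open a b : {set T} := [set x | (pos a < pos x <= pos b)%N].

(** The half-open interval is a gap of the block containing the smallest point of S: it goes from
    a point a of that block to the last point b before the next one. Non-crossing blocks
    cannot leave a gap. *)
Lemma ncp_gap S Q : Q \in ncp pos S -> S != set0 -> Q != [set S] ->
  exists a b, [/\ a \in S, b \in S, (pos a < pos b)%N & saturated Q (half_open a b :&: S)].
Proof.
move=> QS /set0Pn[x0 x0S] Q1; have pQ := ncp_partition QS.
have /noncrossingP nc := ncp_noncrossing QS.
have [m mS_ mmin] := arg_minnP pos x0S; have mS : m \in S by [].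
have [T0 T0Q mT0] := partition_cover pQ mS.
have /properP[_ [x xS xT0]] := ncp_neq1 QS Q1 T0Q.
have inS V y : V \in Q -> y \in V -> y \in S.
  by move=> VQ; apply: (subsetP (partitionS pQ VQ)).
have neq y z V : V \in Q -> V != T0 -> y \in V -> z \in T0 -> pos y != pos z.
  move=> VQ VT yV zT; rewrite (inj_eq pos_inj); apply: contraNneq VT => yz.
  by rewrite (partition_eq pQ VQ T0Q yV) ?yz.
have m_lt y V : V \in Q -> V != T0 -> y \in V -> (pos m < pos y)%N.
  move=> VQ VT yV; rewrite ltn_neqAle eq_sym (neq _ _ _ VQ VT yV mT0).
  exact/mmin/(inS V).
have mx : (pos m < pos x)%N.
  have [V VQ xV] := partition_cover pQ xS.
  by apply: (m_lt x V VQ _ xV); apply: contraNneq xT0 => <-.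
have okm : (m \in T0) && (pos m < pos x)%N by rewrite mT0.
have [a /andP[aT ax] amax] :=
  arg_maxnP (P := fun t => (t \in T0) && (pos t < pos x)%N) pos okm.
have {}amax t : t \in T0 -> (pos t < pos x)%N -> (pos t <= pos a)%N.
  by move=> tT tx; apply: amax; rewrite tT.
(* The points beyond a that come before the next point of T0. *)
pose free y := [&& y \in S, (pos a < pos y)%N &
  [forall t in T0, (pos t <= pos a)%N || (pos y < pos t)%N]].
have okx : free x.
  rewrite /free xS ax; apply/forall_inP => t tT.
  have [tx|xt] := ltnP (pos t) (pos x); first by rewrite amax.
  rewrite ltn_neqAle xt andbT orbC; have -> // : pos x != pos t.
  by rewrite (inj_eq pos_inj); apply: contraNneq xT0 => ->.
have [b /and3P[bS ab /forall_inP bfree] bmax] := arg_maxnP (P := free) pos okx.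
exists a, b; split => //; first exact: (inS T0).
apply/saturatedP => U u v UQ uU vU; rewrite !inE => /andP[/andP[au ub] uS].
have vS := inS U v UQ vU; rewrite vS andbT.
have UT : U != T0.
  apply/eqP => UT; rewrite UT in uU.
  have /orP[|] := bfree u uU; first by rewrite leqNgt au.
  by rewrite ltnNge ub.
have mv := m_lt v U UQ UT vU; have neU := neq _ _ U UQ UT.
apply/andP; split; first rewrite ltnNge; last rewrite leqNgt; apply/negP.
  rewrite leq_eqVlt (negPf (neU _ _ vU aT)) /= => va.
  by case/eqP: UT; apply/esym; apply: (nc T0 U T0Q UQ m v a u).
move=> bv.
have /forall_inPn[t tT] : ~~ [forall t in T0, (pos t <= pos a)%N || (pos v < pos t)%N].
  apply/negP => vfree.
  have /bmax/= : free v by rewrite /free vS vfree (ltn_trans ab).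
  by rewrite leqNgt bv.
rewrite negb_or -ltnNge -leqNgt => /andP[a_t tv].
have bt : (pos b < pos t)%N by have := bfree t tT; rewrite leqNgt a_t.
case/eqP: UT; apply/esym; apply: (nc T0 U T0Q UQ a u t v) => //.
  exact: leq_ltn_trans ub bt.
by rewrite ltn_neqAle tv eq_sym (neU _ _ vU tT).
Qed.

(** The order 1 < bar 1 < 2 < bar 2 < ..., with (i, false) for i and (i, true) for bar i. *)
Definition bar_position (x : T * bool) : nat := (pos x.1).*2 + x.2.

Definition layer (b : bool) V : {set T * bool} := [set (i, b) | i in V].

Definition bar_join pi tau : {set {set T * bool}} :=
  [set layer false V | V : {set T} in pi] :|: [set layer true V | V : {set T} in tau].

Lemma mem_layer b V x c : ((x, c) \in layer b V) = (c == b) && (x \in V).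
Proof.
apply/imsetP/andP => [[y yV [-> ->]]|[/eqP-> xV]]; first by rewrite eqxx.
by exists x.
Qed.

Lemma layer_inj b : injective (layer b).
Proof. by move=> V W /setP e; apply/setP => x; have := e (x, b); rewrite !mem_layer eqxx. Qed.

Lemma layer_neq V W : V != set0 -> layer false V = layer true W -> False.
Proof.
by move=> /set0Pn[x xV] /setP/(_ (x, false)); rewrite !mem_layer xV.
Qed.

Lemma bar_position_lt x b y c : (bar_position (x, b) < bar_position (y, c))%N =
  if ~~ b && c then (pos x <= pos y)%N else (pos x < pos y)%N.
Proof.
rewrite /bar_position /=; case: b; case: c => /=;
  rewrite ?addn0 ?addn1 ?ltn_double // ?ltnS ?ltn_double ?leq_double //.
by rewrite ltn_Sdouble.
Qed.

(** Between bar i and bar j lie exactly the points of the half-open interval from i to j, so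
    a block of tau is crossed by no block of pi if and only if these intervals are unions of
    blocks of pi. *)
Lemma bar_join_noncrossing pi tau : partition pi setT -> partition tau setT ->
  reflect [/\ noncrossing pos pi, noncrossing pos tau &
     forall W i j, W \in tau -> i \in W -> j \in W -> saturated pi (half_open i j)]
   (noncrossing bar_position (bar_join pi tau)).
Proof.
move=> p1 p2; apply: (iffP idP) => [/noncrossingP nc|[/noncrossingP n1 /noncrossingP n2 sat]].
  have in1 V : V \in pi -> layer false V \in bar_join pi tau.
    by move=> Vp; rewrite inE imset_f.
  have in2 V : V \in tau -> layer true V \in bar_join pi tau.
    by move=> Vp; rewrite inE orbC imset_f.
  split.
  - apply/noncrossingP => V W Vp Wp a b c d aV bW cV dW ab bc cd.
    apply: (@layer_inj false).
    apply: (nc _ _ (in1 V Vp) (in1 W Wp) (a, false) (b, false) (c, false) (d, false));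
      by rewrite ?mem_layer ?bar_position_lt.
  - apply/noncrossingP => V W Vp Wp a b c d aV bW cV dW ab bc cd.
    apply: (@layer_inj true).
    apply: (nc _ _ (in2 V Vp) (in2 W Wp) (a, true) (b, true) (c, true) (d, true));
      by rewrite ?mem_layer ?bar_position_lt.
  move=> W i j Wt iW jW; apply/saturatedP => V x y Vp xV yV; rewrite !inE => /andP[ix xj].
  have V0 := partition_neq0 p1 Vp.
  apply/andP; split; first rewrite ltnNge; last rewrite leqNgt; apply/negP => h.
    apply: (layer_neq V0 (W := W)).
    apply: (nc _ _ (in1 V Vp) (in2 W Wt) (y, false) (i, true) (x, false) (j, true));
      by rewrite ?mem_layer ?bar_position_lt //=.
  apply: (layer_neq V0 (W := W)); apply/esym.
  apply: (nc _ _ (in2 W Wt) (in1 V Vp) (i, true) (x, false) (j, true) (y, false));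
    by rewrite ?mem_layer ?bar_position_lt //=.
apply/noncrossingP => B C /setUP[] /imsetP[V Vp ->] /setUP[] /imsetP[W Wp ->]
  [a a'] [b b'] [c c'] [d d']; rewrite !mem_layer => /andP[/eqP-> aV] /andP[/eqP-> bW]
  /andP[/eqP-> cV] /andP[/eqP-> dW]; rewrite !bar_position_lt /= => ab bc cd.
- by rewrite (n1 V W Vp Wp a b c d).
- have /saturatedP/(_ V c a Vp cV aV) := sat W b d Wp bW dW.
  by rewrite !inE bc cd => /(_ isT); rewrite ltnNge ab.
- have /saturatedP/(_ W b d Wp bW dW) := sat V a c Vp aV cV.
  by rewrite !inE ab bc => /(_ isT)/andP[_]; rewrite leqNgt cd.
- by rewrite (n2 V W Vp Wp a b c d).
Qed.

Definition kreweras_complement pi kap :=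
  [/\ kap \in ncp pos setT, noncrossing bar_position (bar_join pi kap) &
   forall tau, tau \in ncp pos setT -> noncrossing bar_position (bar_join pi tau) ->
     forall V, V \in tau -> exists2 W, W \in kap & V \subset W].

(** If R were a nontrivial partition above both, a gap (a, b] of R would be a union of blocks of
    pi. Then the partition with the only nontrivial block {a, b} is compatible with pi, so a and
    b lie in one block of kap by maximality, although kap does not link the gap to a. *)
Lemma kreweras_indecomposable pi kap : [set: T] != set0 -> pi \in ncp pos setT ->
  kreweras_complement pi kap -> indecomposable pos fst setT (bar_join pi kap).
Proof.
move=> T0 piT [kapT nc kmax]; have p1 := ncp_partition piT.
apply/indecomposableP => R RT /belowP bel; apply/eqP; apply: contraT => R1.
have pR := ncp_partition RT.
have [a [b [_ _ ab]]] := ncp_gap RT T0 R1; rewrite setIT => sat.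
(* The fibres of f are {a, b} and singletons. *)
pose f x := if x == b then a else x.
pose tau := preim_partition f [set: T].
have ptau : partition tau setT := preim_partitionP _ _.
have tauE V x y : V \in tau -> x \in V -> y \in V -> (pos x < pos y)%N -> x = a /\ y = b.
  move=> /imsetP[z _ ->]; rewrite !inE /= => /eqP-> /eqP; rewrite /f.
  have [->|xb] := eqVneq x b; have [->|yb] := eqVneq y b.
  - by rewrite ltnn.
  - by move=> <-; rewrite ltnNge (ltnW ab).
  - by move=> ->.
  by move=> ->; rewrite ltnn.
have tauT : tau \in ncp pos setT.
  rewrite inE ptau; apply/noncrossingP => V W Vt Wt x y z t xV yW zV tW xy yz zt.
  have [ex _] := tauE V x z Vt xV zV (ltn_trans xy yz).
  have [ey _] := tauE W y t Wt yW tW (ltn_trans yz zt).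
  by move: xy; rewrite ex ey ltnn.
have piR V : V \in pi -> exists2 W, W \in R & V \subset W.
  move=> Vp; have [|W WR sub] := bel (layer false V); first by rewrite inE imset_f.
  exists W => //; apply/subsetP => x xV; apply: (sub (x, false)).
  by rewrite mem_layer.
have nct : noncrossing bar_position (bar_join pi tau).
  apply/bar_join_noncrossing => //; split.
  - exact: ncp_noncrossing piT.
  - exact: ncp_noncrossing tauT.
  move=> W i j Wt iW jW; have [ij|ji] := ltnP (pos i) (pos j).
    have [-> ->] := tauE W i j Wt iW jW ij.
    apply/saturatedP => V x y Vp xV yV; have [U UR /subsetP VU] := piR V Vp.
    by apply: (saturatedP _ _ sat U); rewrite ?VU.
  apply/saturatedP => V x y _ _ _; rewrite inE => /andP[ix xj].
  by have := leq_trans ix (leq_trans xj ji); rewrite ltnn.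
have [V Vt aV] := partition_cover ptau (in_setT a).
have bV : b \in V.
  move: Vt aV => /imsetP[z _ ->]; rewrite !inE /= => /eqP->; rewrite /f eqxx.
  by case: ifP.
have [W Wk /subsetP VW] := kmax tau tauT nct V Vt.
have aW := VW a aV; have bW := VW b bV.
have [|U UR sub] := bel (layer true W); first by rewrite inE orbC imset_f.
have aU : a \in U by apply: (sub (a, true)); rewrite mem_layer.
have bU : b \in U by apply: (sub (b, true)); rewrite mem_layer.
have /saturatedP/(_ U b a UR bU aU) := sat.
by rewrite !inE ltnn ab leqnn => /(_ isT).
Qed.

(** Here tau refines kap. If a block B of kap were broken up by tau, a gap (a, b] of the
    trace of tau on B would be a union of blocks of tau, and of pi as a and b both lie in B;
    the partition into this interval and its complement then contradicts indecomposability. *)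
Lemma indecomposable_kreweras pi tau kap : pi \in ncp pos setT -> tau \in ncp pos setT ->
  noncrossing bar_position (bar_join pi tau) -> indecomposable pos fst setT (bar_join pi tau) ->
  kreweras_complement pi kap -> tau = kap.
Proof.
move=> piT tauT nc irr [kapT nck kmax]; have p1 := ncp_partition piT.
have p2 := ncp_partition tauT; have p3 := ncp_partition kapT.
have /noncrossingP nckap := ncp_noncrossing kapT.
have [_ _ satk] := bar_join_noncrossing p1 p3 nck.
have ref := kmax tau tauT nc.
suff sub : kap \subset tau.
  apply/eqP; rewrite eqEsubset sub andbT; apply/subsetP => V Vt.
  have [x xV] := partition_block p2 Vt.
  have [W Wk xW] := partition_cover p3 (in_setT x).
  by rewrite (partition_eq p2 Vt (subsetP sub W Wk) xV xW).
apply/subsetP => B Bk; apply: contraT => Bt.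
have satB : saturated tau B.
  apply/saturatedP => V x y Vt xV yV xB; have [W Wk /subsetP VW] := ref V Vt.
  by rewrite (partition_eq p3 Bk Wk xB) ?VW.
have nB : blocks_in tau B \in ncp pos B.
  rewrite inE (blocks_in_partition p2 satB (subsetT _)).
  apply: noncrossingS (ncp_noncrossing tauT).
  by apply/subsetP => V; rewrite inE => /andP[].
have [||a [b [aB bB ab satJ]]] := ncp_gap nB.
- exact: partition_neq0 p3 Bk.
- by apply: contraNneq Bt => /setP/(_ B); rewrite !inE eqxx subxx andbT.
have sat1 : saturated pi (half_open a b) := satk B a b Bk aB bB.
have sat2 : saturated tau (half_open a b).
  apply/saturatedP => U u v Ut uU vU uI; have [W Wk /subsetP UW] := ref U Ut.
  have [WB|WB] := eqVneq W B.
    have := saturatedP _ _ satJ U u v; rewrite !in_setI uI -WB !UW //.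
    rewrite inE Ut WB => h; have /andP[] // : (v \in half_open a b) && true.
      apply: h => //; apply/subsetP => x xU; by rewrite -WB UW.
  have ne x y : x \in U -> y \in B -> pos x != pos y.
    move=> xU yB; rewrite (inj_eq pos_inj); apply: contraNneq WB => xy.
    by rewrite (partition_eq p3 Wk Bk (UW x xU)) ?xy.
  move: uI; rewrite !inE => /andP[au ub].
  have ub' : (pos u < pos b)%N by rewrite ltn_neqAle ub ne.
  apply/andP; split; first rewrite ltnNge; last rewrite leqNgt; apply/negP => h.
    have va : (pos v < pos a)%N by rewrite ltn_neqAle h ne.
    by case/eqP: WB; apply: (nckap W B Wk Bk v a u b); rewrite ?UW.
  by case/eqP: WB; apply/esym; apply: (nckap B W Bk Wk a u b v); rewrite ?UW.
have bI : b \in half_open a b by rewrite inE ab leqnn.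
have aI : a \notin half_open a b by rewrite inE ltnn.
set I := half_open a b in sat1 sat2 bI aI.
have cI0 : setT :\: I != set0 by apply/set0Pn; exists a; rewrite inE aI inE.
have I0 : I != set0 by apply/set0Pn; exists b.
have single S : S != set0 -> partition [set S] S.
  by move=> S0; rewrite /partition cover1 eqxx trivIset1 inE eq_sym.
have dis : [disjoint I & setT :\: I].
  by rewrite setTD -setI_eq0 setICr.
have RT : [set I] :|: [set setT :\: I] \in ncp pos setT.
  rewrite inE; apply/andP; split.
    have := partitionU (single I I0) (single _ cI0) dis.
    by rewrite setTD setUCr.
  rewrite (noncrossingU_order_convex (S := setT) (I := I)) ?single //.
    by rewrite !noncrossing1.
  apply/order_convexP => x y z; rewrite !inE => /andP[ax xb] /andP[ay yb] _ xz zy.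
  by rewrite (ltn_trans ax xz) (leq_trans (ltnW zy) yb).
have half Q d : partition Q setT -> saturated Q I -> forall V, V \in Q ->
   exists2 W, W \in [set I] :|: [set setT :\: I] & forall x, x \in layer d V -> x.1 \in W.
  move=> pQ /forall_inP satQ V VQ; have /orP[VI|VI] := satQ V VQ.
    exists I; first by rewrite !inE eqxx.
    by move=> [x c]; rewrite mem_layer => /andP[_ /(subsetP VI)].
  exists (setT :\: I); first by rewrite !inE eqxx orbT.
  move=> [x c]; rewrite mem_layer => /andP[_ xV].
  by rewrite !inE andbT; have := disjointFr VI xV; rewrite inE => ->.
have RE : [set I] :|: [set setT :\: I] = [set setT].
  apply: (indecomposableP _ _ _ _ irr _ RT); apply/belowP => B' /setUP[] /imsetP[V VQ ->].
    exact: half p1 sat1 V VQ.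
  exact: half p2 sat2 V VQ.
have : I \in [set setT] by rewrite -RE !inE eqxx.
by move=> /set1P IT; rewrite IT inE in aI.
Qed.

End Kreweras.

Section KrewerasSum.
Variables (T : finType) (pos : T -> nat) (pos_inj : injective pos).
Hypothesis T_neq0 : [set: T] != set0.
Variables (K : fieldType) (w : {set T * bool} -> K).
Hypothesis w0 : forall (B : {set T * bool}) x y, x \in B -> y \in B -> x.2 != y.2 -> w B = 0.
Variable kap : {set {set T}} -> {set {set T}}.
Hypothesis kapP : forall pi, pi \in ncp pos setT -> kreweras_complement pos pi (kap pi).
Implicit Types (S V W : {set T}) (pi tau : {set {set T}}) (P : {set {set T * bool}}).

(** The inverse of bar_join on coloured partitions. *)
Definition layer_part b P : {set {set T}} := [set V | layer b V \in P].

Lemma layer_part_bar_join pi tau b : partition pi setT -> partition tau setT ->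
  layer_part b (bar_join pi tau) = if b then tau else pi.
Proof.
move=> p1 p2; apply/setP => V; rewrite !inE.
have mixed W1 W2 : W1 != set0 -> layer true W1 = layer false W2 -> False.
  by move=> /set0Pn[x xW] /setP/(_ (x, true)); rewrite !mem_layer xW.
apply/orP/idP.
  case: b => -[] /imsetP[W Wp].
  - by move=> e; have := mixed V W; rewrite e; case: eqVneq => [V0|_ /(_ isT erefl)//];
      case: (layer_neq (partition_neq0 p1 Wp) (esym e)).
  - by move/layer_inj->.
  - by move/layer_inj->.
  by move=> e; case: (mixed W V (partition_neq0 p2 Wp) (esym e)).
by case: b => Vp; [right|left]; rewrite imset_f.
Qed.

Lemma bar_join_partition pi tau : partition pi setT -> partition tau setT ->
  partition (bar_join pi tau) setT.
Proof.
move=> p1 p2.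
have layerP b Q : partition Q setT ->
    partition [set layer b V | V : {set T} in Q] (layer b setT).
  by move=> pQ; rewrite imset_partition // => x y [].
have dis : [disjoint layer false [set: T] & layer true [set: T]].
  by rewrite -setI_eq0; apply/eqP/setP => -[x b]; rewrite !inE !mem_layer !inE; case: b.
have -> : [set: T * bool] = layer false [set: T] :|: layer true [set: T].
  by apply/setP => -[x b]; rewrite !inE !mem_layer !inE; case: b.
exact: partitionU (layerP false pi p1) (layerP true tau p2) dis.
Qed.

Lemma prod_bar_join pi tau : partition pi setT -> partition tau setT ->
  \prod_(B in bar_join pi tau) w B =
  (\prod_(V in pi) w (layer false V)) * (\prod_(V in tau) w (layer true V)).
Proof.
move=> p1 p2; set P1 := [set layer false V | V : {set T} in pi].
set P2 := [set layer true V | V : {set T} in tau].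
rewrite (eq_bigl [in [predU P1 & P2]]) => [|B]; last by rewrite !inE.
rewrite bigU /=; last first.
  apply/pred0P => B /=; apply/negP => /andP[/imsetP[V Vp ->] /imsetP[W _]].
  exact: layer_neq (partition_neq0 p1 Vp).
by congr (_ * _); rewrite big_imset //= => V W _ _; apply: layer_inj.
Qed.

Definition coloured P := [forall B in P, [exists b, B \subset layer b setT]].

Lemma colouredP P : reflect
  (forall B, B \in P -> exists b V, B = layer b V) (coloured P).
Proof.
apply: (iffP forall_inP) => col B BP.
  have /existsP[b /subsetP Bb] := col B BP; exists b, [set x | (x, b) \in B].
  apply/setP => -[x c]; rewrite mem_layer inE.
  have [-> //|cb] := eqVneq c b; apply/negP => /Bb.
  by rewrite mem_layer (negPf cb).
have [b [V ->]] := col B BP; apply/existsP; exists b.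
by apply/subsetP => -[x c]; rewrite !mem_layer inE => /andP[->].
Qed.

Lemma uncoloured_prod P : ~~ coloured P -> \prod_(B in P) w B = 0.
Proof.
move=> /forall_inPn[B BP]; rewrite negb_exists => /forallP nc.
have /subsetPn[[x b] xB] := nc true; rewrite mem_layer inE andbT => bF.
have /subsetPn[[y c] yB] := nc false; rewrite mem_layer inE andbT => cT.
by rewrite (bigD1 B) //= (w0 xB yB) ?mul0r //=; move: bF cT; case: b {xB}; case: c {yB}.
Qed.

Lemma coloured_bar_join P : partition P setT -> coloured P ->
  bar_join (layer_part false P) (layer_part true P) = P.
Proof.
move=> pP /colouredP col; apply/setP => B; rewrite inE; apply/orP/idP.
  by move=> [] /imsetP[V]; rewrite inE => VP ->.
move=> BP; have [b [V e]] := col B BP.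
by case: b e BP => -> BP; [right|left]; rewrite imset_f // inE.
Qed.

Lemma layer_part_ncp P b : P \in ncp (bar_position pos) setT -> coloured P ->
  layer_part b P \in ncp pos setT.
Proof.
move=> PT /colouredP col; have pP := ncp_partition PT.
rewrite inE; apply/andP; split.
  apply: partition_intro.
  - move=> V; rewrite inE => /(partition_neq0 pP)/set0Pn[[x c]].
    by rewrite mem_layer => /andP[_ xV]; apply/set0Pn; exists x.
  - by move=> V _; apply: subsetT.
  - move=> x _; have [B BP xB] := partition_cover pP (in_setT (x, b)).
    have [c [V e]] := col B BP; move: xB BP; rewrite e mem_layer => /andP[/eqP<- xV] VP.
    by exists V; rewrite ?inE.
  move=> V W x; rewrite !inE => VP WP xV xW; apply: (@layer_inj _ b).
  by apply: (partition_eq (x := (x, b)) pP VP WP); rewrite mem_layer eqxx.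
have /noncrossingP nc := ncp_noncrossing PT.
apply/noncrossingP => V W; rewrite !inE => VP WP x y z t xV yW zV tW xy yz zt.
apply: (@layer_inj _ b); apply: (nc _ _ VP WP (x, b) (y, b) (z, b) (t, b));
  by rewrite ?mem_layer ?eqxx // bar_position_lt andNb.
Qed.

(** Partitions with a block of two colours have weight zero; the others are pairs of
    non-crossing partitions, and indecomposability leaves one choice for the second one. *)
Theorem indecomposable_sum_kreweras :
  indecomposable_sum (bar_position pos) pos fst w setT =
  \sum_(pi in ncp pos setT)
    (\prod_(V in pi) w (layer false V)) * (\prod_(V in kap pi) w (layer true V)).
Proof.
rewrite /indecomposable_sum preimsetT (bigID coloured) /= [X in _ + X]big1 ?addr0; last first.
  by move=> P /andP[_]; apply: uncoloured_prod.
rewrite (reindex_onto (fun pi => bar_join pi (kap pi)) (layer_part false)) /=.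
  apply: eq_big => [pi|pi /andP[/andP[/andP[PT _] col] /eqP e]]; last first.
    have piT := layer_part_ncp false PT col; rewrite e in piT.
    have [kT _ _] := kapP piT; exact: prod_bar_join (ncp_partition piT) (ncp_partition kT).
  apply/idP/idP.
    move=> /andP[/andP[/andP[PT _] col] /eqP <-]; exact: layer_part_ncp.
  move=> piT; have kP := kapP piT; have [kT nc _] := kP.
  have p1 := ncp_partition piT; have p2 := ncp_partition kT.
  rewrite (layer_part_bar_join false p1 p2) eqxx andbT inE bar_join_partition // nc /=.
  rewrite kreweras_indecomposable //=; apply/colouredP => B /setUP[] /imsetP[V _ ->].
    by exists false, V.
  by exists true, V.
move=> P /andP[/andP[PT ind] col]; have pP := ncp_partition PT.
have l1 := layer_part_ncp false PT col; have l2 := layer_part_ncp true PT col.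
have e := coloured_bar_join pP col.
have nc := ncp_noncrossing PT; rewrite -e in nc ind.
have ek := indecomposable_kreweras pos_inj l1 l2 nc ind (kapP l1).
by rewrite -[in LHS]ek.
Qed.

End KrewerasSum.

(** * Cumulants of lists and the order of s_chi *)

Section Transport.
Variables (T T1 : finType) (pos : T -> nat) (pos1 : T1 -> nat) (f : T -> T1).
Hypothesis f_inj : injective f.
Hypothesis f_pos : forall x y, (pos1 (f x) < pos1 (f y))%N = (pos x < pos y)%N.

Definition image_part (P : {set {set T}}) : {set {set T1}} := [set f @: (V : {set T}) | V in P].

Lemma noncrossing_imset (P : {set {set T}}) : noncrossing pos1 (image_part P) = noncrossing pos P.
Proof.
apply/noncrossingP/noncrossingP => nc V W.
  move=> VP WP a b c d aV bW cV dW ab bc cd; apply: (imset_inj f_inj).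
  by apply: (nc _ _ (imset_f _ VP) (imset_f _ WP) (f a) (f b) (f c) (f d));
    rewrite ?imset_f ?f_pos.
move=> /imsetP[V0 VP ->] /imsetP[W0 WP ->] _ _ _ _ /imsetP[a aV ->] /imsetP[b bW ->]
  /imsetP[c cV ->] /imsetP[d dW ->]; rewrite !f_pos => ab bc cd.
by rewrite (nc V0 W0 VP WP a b c d).
Qed.

Lemma ncp_imset (P : {set {set T}}) (S : {set T}) :
  (image_part P \in ncp pos1 (f @: S)) = (P \in ncp pos S).
Proof. by rewrite !inE noncrossing_imset imset_partition. Qed.

(** Only the relative order of positions matters. *)
Lemma ncsum_imset (K : fieldType) (w : {set T1} -> K) (S : {set T}) :
  ncsum pos1 w (f @: S) = ncsum pos (fun V => w (f @: V)) S.
Proof.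
have fK (V : {set T}) : f @^-1: (f @: V) = V.
  by apply/setP => x; rewrite inE (mem_imset _ _ f_inj).
rewrite /ncsum (reindex_onto image_part
  (fun P => [set f @^-1: (B : {set T1}) | B in P])) /=.
  apply: eq_big => [P|P _].
    rewrite ncp_imset; case: (P \in _) => //=; apply/eqP.
    rewrite /image_part -imset_comp -[RHS]imset_id; apply: eq_imset => V /=.
    exact: fK.
  by rewrite big_imset //= => V W _ _; apply: (imset_inj f_inj).
move=> P PS; rewrite /image_part -imset_comp -[RHS]imset_id.
apply: eq_in_imset => B BP /=; apply/setP => y.
have /subsetP BS := partitionS (ncp_partition PS) BP.
apply/imsetP/idP => [[x + ->]|yB]; first by rewrite inE.
by have /imsetP[x _ e] := BS y yB; exists x; rewrite // inE -e.
Qed.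

End Transport.

Lemma pairwise_rev (T : Type) (r : rel T) s :
  pairwise r (rev s) = pairwise (fun x y => r y x) s.
Proof.
by elim: s => //= x s IH; rewrite rev_cons pairwise_rcons all_rev IH.
Qed.

Lemma enum_ord_ltn n : pairwise (fun i j : 'I_n => (i < j)%N) (enum 'I_n).
Proof.
have := pairwise_map (fun i : 'I_n => val i) ltn (enum 'I_n).
by rewrite val_enum_ord -(sorted_pairwise ltn_trans) iota_ltn_sorted => <-.
Qed.

Section ChiOrder.
Variables (n : nat) (chi : 'I_n -> face).

Definition chi_pos (i : 'I_n) : nat := val ((s_chi chi)^-1%g i).

Lemma chi_pos_inj : injective chi_pos.
Proof. by move=> i j /val_inj/perm_inj. Qed.

Lemma chi_posK i : chi_pos (s_chi chi i) = i.
Proof. by rewrite /chi_pos permK. Qed.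

(** The order s_chi(1), s_chi(2), ...: left indices increasingly, then right ones decreasingly. *)
Definition chi_before (i j : 'I_n) : bool :=
  if chi i == lft then (chi j == rgt) || (i < j)%N else (chi j == rgt) && (j < i)%N.

Lemma s_chi_seq_before : pairwise chi_before (s_chi_seq chi).
Proof.
have lt_enum := enum_ord_ltn n.
rewrite pairwise_cat; apply/and3P; split.
- apply/allrelP => i j; rewrite mem_rev !mem_filter => /andP[ci _] /andP[cj _].
  by rewrite /chi_before ci cj.
- have := pairwise_filter (fun i => chi i == lft) lt_enum.
  apply: (sub_in_pairwise (P := [pred i | chi i == lft])); last exact: filter_all.
  by move=> i j; rewrite !inE => ci _ ij; rewrite /chi_before ci ij orbT.
rewrite pairwise_rev; have := pairwise_filter (fun i => chi i == rgt) lt_enum.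
apply: (sub_in_pairwise (P := [pred i | chi i == rgt])); last exact: filter_all.
by move=> i j; rewrite !inE => /eqP ci /eqP cj ij; rewrite /chi_before ci cj ij.
Qed.

Lemma chi_pos_before i j : (chi_pos i < chi_pos j)%N -> chi_before i j.
Proof.
have sz : size (s_chi_seq chi) = n by rewrite (perm_size (s_chi_perm_eq chi)) size_enum_ord.
set s := s_chi chi; pose k := (s^-1)%g i; pose k' := (s^-1)%g j.
have ik : i = nth i (s_chi_seq chi) k.
  by rewrite -[LHS](permKV s) permE /s_chi_fun; apply: set_nth_default; rewrite sz.
have jk : j = nth i (s_chi_seq chi) k'.
  by rewrite -[LHS](permKV s) permE /s_chi_fun; apply: set_nth_default; rewrite sz.
move=> kk'; rewrite [X in chi_before X _]ik [X in chi_before _ X]jk.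
by apply: (pairwiseP i s_chi_seq_before); rewrite ?inE ?sz ?ltn_ord.
Qed.

Lemma chi_sorted_before (g : 'I_n -> nat) : injective g ->
  chi_sorted chi g (enum 'I_n) -> forall i j, chi_before i j -> (g i < g j)%N.
Proof.
move=> g_inj srt i j; have x0 := i.
have H (i1 i2 : 'I_n) : (i1 < i2)%N -> if chi i1 == lft then (g i1 < g i2)%N else (g i2 < g i1)%N.
  move=> lt; have := pairwiseP x0 srt i1 i2; rewrite !inE size_enum_ord !ltn_ord.
  rewrite !nth_ord_enum => /(_ isT isT lt).
  have ne : g i1 != g i2 by rewrite (inj_eq g_inj) -val_eqE /= ltn_eqF.
  by case: ifP => _ le; rewrite ltn_neqAle le andbT // eq_sym.
rewrite /chi_before; case ci: (chi i == lft).
  have [ij _|ji|/val_inj <-] := ltngtP i j.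
  - by have := H i j ij; rewrite ci.
  - by rewrite orbF => /eqP cj; have := H j i ji; rewrite cj.
  by rewrite (eqP ci) orbF.
by move=> /andP[/eqP cj ji]; have := H j i ji; rewrite cj.
Qed.

(** Every position function compatible with chi induces the order of s_chi. *)
Lemma chi_pos_unique (g : 'I_n -> nat) : injective g -> chi_sorted chi g (enum 'I_n) ->
  forall i j, (chi_pos i < chi_pos j)%N = (g i < g j)%N.
Proof.
move=> g_inj srt; have homo i j : (chi_pos i < chi_pos j)%N -> (g i < g j)%N.
  by move/chi_pos_before; apply: chi_sorted_before.
move=> i j; have [ij|ji|/chi_pos_inj->] := ltngtP (chi_pos i) (chi_pos j).
- by rewrite homo.
- by rewrite ltnNge (ltnW (homo _ _ ji)).
by rewrite ltnn.
Qed.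

Lemma chi_pos_sorted : chi_sorted chi chi_pos (enum 'I_n).
Proof.
apply: sub_pairwise (enum_ord_ltn n) => i j ij.
case: ifP => ci; rewrite leqNgt; apply/negP => /chi_pos_before; rewrite /chi_before.
  by rewrite ltnNge (ltnW ij) (eqP ci) /=; case: ifP.
by rewrite ci ltnNge (ltnW ij) andbF.
Qed.

Lemma mem_BNC pi : (pi \in BNC chi) = (pi \in ncp chi_pos setT).
Proof.
set s := ((s_chi chi)^-1)%g; have s_inj : injective s by apply: perm_inj.
rewrite -(ncp_imset (pos1 := val) s_inj) // !inE.
have -> : s @: [set: 'I_n] = setT.
  apply/setP => i; rewrite !inE; apply/imsetP; exists (s_chi chi i); rewrite ?inE //.
  by rewrite permK.
by [].
Qed.

Lemma K_BNC_kreweras pi : pi \in BNC chi -> kreweras_complement chi_pos pi (K_BNC chi pi).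
Proof.
move=> piB; set s := s_chi chi; set sigma := act_part s^-1%g pi.
have sNC : sigma \in NC n by move: piB; rewrite inE.
have /and3P[kNC knc kmax] := K_NCP sNC.
have piE : pi = act_part s sigma by rewrite /sigma -[s in act_part s](invgK s) act_partK.
(* An order isomorphism onto the doubled indices. *)
pose psi (x : 'I_n + 'I_n) : 'I_n * bool :=
  match x with inl i => (s i, false) | inr i => (s i, true) end.
have psi_inj : injective psi.
  by move=> [i|i] [j|j] //= [] /perm_inj->.
have joinE tau : image_part psi (bar_union sigma tau) = bar_join pi (act_part s tau).
  rewrite /image_part /bar_union /bar_join piE /act_part imsetU -!imset_comp.
  by congr (_ :|: _); apply: eq_imset => V; rewrite /layer /= -!imset_comp.
have psi_pos x y : (bar_position chi_pos (psi x) < bar_position chi_pos (psi y))%N =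
    (bar_pos x < bar_pos y)%N.
  suff e z : bar_position chi_pos (psi z) = bar_pos z by rewrite !e.
  by case: z => i; rewrite /bar_position /= chi_posK ?addn0 ?addn1.
have ncE tau : noncrossing (bar_position chi_pos) (bar_join pi (act_part s tau)) =
    noncrossing (@bar_pos n) (bar_union sigma tau).
  by rewrite -joinE (noncrossing_imset psi_inj psi_pos).
split.
- by rewrite -mem_BNC inE /K_BNC act_partK.
- by rewrite /K_BNC -/s ncE.
move=> tau; rewrite -mem_BNC inE -/s => tNC.
have tE : tau = act_part s (act_part s^-1%g tau) by rewrite -[s in act_part s](invgK s) act_partK.
rewrite tE ncE => tnc V /imsetP[V0 V0t ->].
have /forall_inP/(_ _ V0t)/exists_inP[W WK VW] := implyP (forall_inP kmax _ tNC) tnc.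
by exists (s @: W); [rewrite /K_BNC imset_f | apply: imsetS].
Qed.

End ChiOrder.

Section ListCumulants.
Variables (K : fieldType) (A : algType K) (phi : {scalar A}).
Variables (kappa : multifunctional A) (kappaP : bifree_cumulants phi kappa).

Lemma kappa_cast m1 m2 (c1 : 'I_m1 -> face) (c2 : 'I_m2 -> face)
    (a1 : 'I_m1 -> A) (a2 : 'I_m2 -> A) : m1 = m2 ->
  (forall (i : 'I_m1) (j : 'I_m2), val i = val j -> c1 i = c2 j /\ a1 i = a2 j) ->
  kappa c1 a1 = kappa c2 a2.
Proof.
move=> e; case: m2 / e c2 a2 => c2 a2 h; congr kappa.
  by apply: boolp.funext => i; have [] := h i i erefl.
by apply: boolp.funext => i; have [] := h i i erefl.
Qed.

Section OneType.
Variables (T : eqType) (chi : T -> face) (a : T -> A).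

Definition list_kappa (s : seq T) : K :=
  kappa (fun t => chi (tnth (in_tuple s) t)) (fun t => a (tnth (in_tuple s) t)).

Lemma list_kappa_eq m (c1 : 'I_m -> face) (a1 : 'I_m -> A) (s : seq T) : size s = m ->
  (forall x0 (i : 'I_m), c1 i = chi (nth x0 s i) /\ a1 i = a (nth x0 s i)) ->
  kappa c1 a1 = list_kappa s.
Proof.
move=> sz h; apply: kappa_cast => // i j ij.
have e : tnth (in_tuple s) j = nth (tnth (in_tuple s) j) s i.
  by rewrite ij; apply: tnth_nth.
by have [-> ->] := h (tnth (in_tuple s) j) i; rewrite -e.
Qed.
End OneType.

Lemma list_kappa_map (T1 T2 : eqType) (f : T1 -> T2) chi a s :
  list_kappa chi a (map f s) = list_kappa (chi \o f) (a \o f) s.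
Proof.
apply/esym/list_kappa_eq; first by rewrite size_map.
move=> x0 i; rewrite (nth_map (tnth (in_tuple s) i)) //.
by rewrite -[nth _ s i](tnth_nth (tnth (in_tuple s) i) (in_tuple s) i).
Qed.

Lemma kappa_restr n (chi : 'I_n -> face) (a : 'I_n -> A) (V : {set 'I_n}) :
  kappa (restr (V:=V) chi) (restr (V:=V) a) = list_kappa chi a (enum V).
Proof.
apply: list_kappa_eq; first by rewrite cardE.
by move=> x0 i; rewrite /restr (enum_val_nth x0).
Qed.

(** The defining formula of the cumulants, for factors indexed by any list: numbering the
    list turns its order of positions into the order of s_chi. *)
Theorem moment_cumulant (T : finType) (pos : T -> nat) (chi : T -> face) (a : T -> A) (s : seq T) :
  injective pos -> uniq s -> chi_sorted chi pos s -> s != [::] ->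
  phi (\prod_(x <- s) a x) =
  ncsum pos (fun B => list_kappa chi a [seq x <- s | x \in B]) [set x in s].
Proof.
move=> pos_inj us srt s0; set n := size s.
pose f (i : 'I_n) := tnth (in_tuple s) i.
have f_inj : injective f by apply/tuple_uniqP.
have fs : [seq f i | i <- enum 'I_n] = s.
  by rewrite -[RHS]/(tval (in_tuple s)) -[in RHS](map_tnth_enum (in_tuple s)).
have n0 : (0 < n)%N by rewrite lt0n size_eq0.
have srtf : chi_sorted (chi \o f) (pos \o f) (enum 'I_n).
  by move: srt; rewrite -{1}fs /chi_sorted pairwise_map.
have pf_inj : injective (pos \o f) by apply: inj_comp.
have pos_f i j : (pos (f i) < pos (f j))%N = (chi_pos (chi \o f) i < chi_pos (chi \o f) j)%N.
  by rewrite (chi_pos_unique pf_inj srtf).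
rewrite big_tnth -/n (kappaP.2 n (chi \o f) (a \o f) n0).
have -> : [set x in s] = f @: [set: 'I_n].
  apply/setP => x; rewrite inE -{1}fs; apply/mapP/imsetP => -[i _ ->]; exists i => //.
  by rewrite mem_enum.
rewrite (ncsum_imset f_inj pos_f) /ncsum; apply: eq_big => [pi|pi _]; first exact: mem_BNC.
apply: eq_bigr => V _; rewrite kappa_restr.
have -> : [seq x <- s | x \in f @: V] = map f (enum V).
  rewrite -{1}fs filter_map; congr map; rewrite enumT [in RHS]/enum_mem.
  by apply: eq_filter => i /=; rewrite (mem_imset _ _ f_inj).
by rewrite list_kappa_map.
Qed.
End ListCumulants.

(** * Splitting each variable into its two factors *)

Section Doubling.
Variables (T : finType) (chi : T -> face) (pos : T -> nat) (pos_inj : injective pos).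
Implicit Types (t : seq T).

(** The factors of the product at i in the order of multiplication. That order is reversed on
    the right face, and so are positions, so (i, false) has the smaller position on either
    face. *)
Definition factors (i : T) : seq (T * bool) :=
  if chi i == lft then [:: (i, false); (i, true)] else [:: (i, true); (i, false)].

Definition interleave t : seq (T * bool) := flatten (map factors t).

Definition chi2 (x : T * bool) : face := chi x.1.

Lemma mem_factors i x : (x \in factors i) = (x.1 == i).
Proof.
rewrite /factors; case: x => j b; case: ifP => _; rewrite !inE !xpair_eqE /=;
  by case: (j == i); case: b.
Qed.

Lemma mem_interleave t x : (x \in interleave t) = (x.1 \in t).
Proof. by elim: t => //= i t IH; rewrite mem_cat IH mem_factors inE. Qed.

Lemma uniq_interleave t : uniq t -> uniq (interleave t).
Proof.
elim: t => //= i t IH /andP[it ut]; rewrite cat_uniq IH // andbT; apply/andP; split.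
  by rewrite /factors; case: ifP => _ /=; rewrite !inE xpair_eqE andbF.
by apply/hasPn => x; rewrite mem_interleave mem_factors => xt; apply: contraNneq it => <-.
Qed.

Lemma filter_interleave (S : {pred T}) t :
  [seq x <- interleave t | x.1 \in S] = interleave [seq i <- t | i \in S].
Proof.
elim: t => //= i t IH; rewrite filter_cat IH /factors.
by case: ifP => ci /=; case: (i \in S) => //=; rewrite /interleave /= /factors ci.
Qed.

Lemma filter_layer_interleave b (V : {set T}) t :
  [seq x <- interleave t | x \in layer b V] = [seq (i, b) | i <- t & i \in V].
Proof.
elim: t => //= i t IH; rewrite filter_cat IH /factors.
by case: ifP => ci /=; rewrite !mem_layer; case: (i \in V) => //=; case: (b).
Qed.

Lemma interleave_sorted t : uniq t -> chi_sorted chi pos t ->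
  chi_sorted chi2 (bar_position pos) (interleave t).
Proof.
elim: t => //= i t IH /andP[it ut] /andP[/allP itt srt].
rewrite /chi_sorted pairwise_cat; apply/and3P; split; last exact: IH.
  apply/allrelP => -[j b] [k c]; rewrite mem_factors mem_interleave /= => /eqP-> kt.
  have ne : pos i != pos k.
    by rewrite (inj_eq pos_inj); apply: contraNneq it => ->.
  have := itt k kt; rewrite /chi2 /=; case: ifP => _ le; apply: ltnW.
    by rewrite bar_position_lt ltn_neqAle ne le; case: ifP.
  by rewrite bar_position_lt ltn_neqAle eq_sym ne le; case: ifP.
rewrite /factors /chi2; case: ifP => /= ci; rewrite ci /= !andbT;
  by apply: ltnW; rewrite bar_position_lt /=.
Qed.

End Doubling.

Section Multiplication.
Variables (K : fieldType) (A : algType K) (phi : {scalar A}) (phi1 : phi 1 = 1).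
Variables (kappa : multifunctional A) (kappaP : bifree_cumulants phi kappa).
Variables (z1 z2 : two_faced A) (z12 : bifree phi z1 z2).
Variables (n : nat) (n_gt0 : (0 < n)%N) (chi : 'I_n -> face).

Local Notation z := (TwoFaced (left_el z1 * left_el z2) (right_el z2 * right_el z1)).
Local Notation pos := (chi_pos chi).
Local Notation pos2 := (bar_position (chi_pos chi)).
Local Notation E := (enum 'I_n).

Definition factor (x : 'I_n * bool) : A := (if x.2 then z2 else z1) (chi x.1).

Lemma prod_interleave t : \prod_(x <- interleave chi t) factor x = \prod_(i <- t) z (chi i).
Proof.
elim: t => [|i t IH]; first by rewrite !big_nil.
rewrite big_cons -IH /interleave /= big_cat /=; congr (_ * _).
rewrite /factors /factor /tf_el; case: ifP => /= ci;
  by rewrite !big_cons big_nil /= ci mulr1.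
Qed.

Definition colour_weight (B : {set 'I_n * bool}) : K :=
  if coloured [set B] then
    list_kappa kappa (chi2 chi) factor [seq x <- interleave chi E | x \in B]
  else 0.

Lemma colour_weight_mixed (B : {set 'I_n * bool}) x y :
  x \in B -> y \in B -> x.2 != y.2 -> colour_weight B = 0.
Proof.
move=> xB yB; rewrite /colour_weight; case: ifP => // /colouredP/(_ B (set11 B)).
case=> b [V e]; rewrite e in xB yB; move: x y xB yB => [x c] [y d].
by rewrite !mem_layer => /andP[/eqP-> _] /andP[/eqP-> _]; rewrite eqxx.
Qed.

Lemma colour_weight_layer b V : colour_weight (layer b V) =
  kappa (restr (V:=V) chi) (restr (V:=V) (fun i => (if b then z2 else z1) (chi i))).
Proof.
rewrite /colour_weight ifT; last first.
  by apply/colouredP => B /set1P->; exists b, V.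
rewrite filter_layer_interleave list_kappa_map kappa_restr; congr list_kappa.
by rewrite enumT.
Qed.

(** Blocks of a single colour carry cumulants of one of the two families, for which the
    moment-cumulant formula holds; mixed_moment_ncsum extends it to all lists. *)
Lemma moment_colour_weight s : subseq s (interleave chi E) ->
  phi (\prod_(x <- s) factor x) = ncsum pos2 colour_weight [set x in s].
Proof.
have pos2_inj : injective pos2.
  move=> [i b] [j c] /eqP; rewrite /bar_position /= => /eqP e.
  have bc : b = c by have := congr1 odd e; rewrite !oddD !odd_double; case: b {e}; case: c.
  rewrite bc in e *; move/addIn/double_inj: e => e.
  by rewrite (chi_pos_inj e).
have u2 : uniq (interleave chi E) by rewrite uniq_interleave ?enum_uniq.
have s2 : chi_sorted (chi2 chi) pos2 (interleave chi E).
  by apply: interleave_sorted (@chi_pos_inj _ _) _ (enum_uniq _) (chi_pos_sorted chi).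
move=> sub; have := mixed_moment_ncsum phi1 z12 pos2_inj u2 s2 (c := snd)
  colour_weight_mixed _ sub; apply => d t td t0 /allP mono.
have ut := subseq_uniq td u2.
rewrite /mixed_moment.
rewrite (moment_cumulant kappaP (chi := chi2 chi) factor pos2_inj ut _ t0); last first.
  by move: s2; apply: subseq_pairwise.
apply: eq_bigr => P PS; apply: eq_bigr => B BP.
have /subsetP Bt := partitionS (ncp_partition PS) BP.
rewrite /colour_weight ifT; last first.
  apply/forall_inP => C /set1P->; apply/existsP; exists d; apply/subsetP => -[x b] xB.
  by have := Bt _ xB; rewrite mem_layer !inE andbT; apply: mono.
congr list_kappa; rewrite [in LHS](subseq_uniqP u2 td) -filter_predI.
apply: eq_filter => x /=; case: (boolP (x \in B)) => //= /Bt.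
by rewrite inE.
Qed.

(** Both list_kappa of the products and indecomposable_sum have the moments of z as sums over
    non-crossing partitions, hence they agree. *)
Theorem kappa_product :
  kappa chi (fun i => z (chi i)) =
  \sum_(pi in BNC chi)
    kappa_part kappa chi pi (fun i => z1 (chi i)) *
    kappa_part kappa chi (K_BNC chi pi) (fun i => z2 (chi i)).
Proof.
pose kz (S : {set 'I_n}) := list_kappa kappa chi (fun i => z (chi i)) [seq i <- E | i \in S].
have T0 : [set: 'I_n] != set0.
  by apply/set0Pn; exists (Ordinal n_gt0); rewrite inE.
have p_mono x y : (pos2 x < pos2 y)%N -> (pos x.1 <= pos y.1)%N.
  case: x => x b; case: y => y c; rewrite bar_position_lt /=.
  by case: ifP => // _ /ltnW.
have kzE S : S != set0 -> kz S = indecomposable_sum pos2 pos fst colour_weight S.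
  apply: (ncsum_inj (pos := pos)) => {}S S0.
  rewrite -(ncsum_preimset (@chi_pos_inj _ chi) p_mono) //.
  pose s := [seq i <- E | i \in S].
  have sS : [set x in s] = S by apply/setP => i; rewrite inE mem_filter mem_enum andbT.
  have us : uniq s by rewrite filter_uniq ?enum_uniq.
  transitivity (phi (\prod_(i <- s) z (chi i))).
    rewrite (moment_cumulant kappaP (chi := chi) (fun i => z (chi i)) (@chi_pos_inj _ chi) us).
    - rewrite sS; apply: eq_bigr => P PS; apply: eq_bigr => B BP.
      have /subsetP BS := partitionS (ncp_partition PS) BP.
      congr list_kappa; rewrite /s -filter_predI; apply: eq_filter => i /=.
      by case: (boolP (i \in B)) => //= /BS ->.
    - by apply: subseq_pairwise (filter_subseq _ _) (chi_pos_sorted chi).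
    have /set0Pn[i iS] := S0; rewrite -sS inE in iS.
    by apply: contraTneq iS => ->.
  rewrite -prod_interleave -filter_interleave moment_colour_weight ?filter_subseq //.
  congr (ncsum _ _ _); apply/setP => x.
  by rewrite !inE mem_filter mem_interleave mem_enum andbT.
have -> : kappa chi (fun i => z (chi i)) = kz setT.
  rewrite /kz; have -> : [seq i <- E | i \in [set: 'I_n]] = E.
    by apply/all_filterP/allP => i _; rewrite inE.
  apply: list_kappa_eq; first exact: size_enum_ord.
  by move=> x0 i; rewrite nth_ord_enum.
rewrite kzE // (indecomposable_sum_kreweras (@chi_pos_inj _ chi) T0 colour_weight_mixed
  (kap := K_BNC chi)); last first.
  by move=> pi piT; apply: K_BNC_kreweras; rewrite mem_BNC.
apply: eq_big => [pi|pi _]; first by rewrite mem_BNC.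
by congr (_ * _); apply: eq_bigr => V _; rewrite colour_weight_layer.
Qed.

End Multiplication.

Theorem theorem5p2p1 (R : realType) (A : algType R[i]) (phi : {scalar A})
    (phi1 : phi 1 = 1)
    (kappa : multifunctional A) (kappaP : bifree_cumulants phi kappa)
    (z' z'' : two_faced A) (z'_z''_bifree : bifree phi z' z'') :
  let z := TwoFaced (left_el z' * left_el z'') (right_el z'' * right_el z') in
  forall (n : nat) (chi : 'I_n -> face), (1 <= n)%N ->
    kappa n chi (fun i => z (chi i)) =
    \sum_(pi in BNC chi)
      kappa_part kappa chi pi (fun i => z' (chi i)) *
      kappa_part kappa chi (K_BNC chi pi) (fun i => z'' (chi i)).
Proof. by move=> z n chi n_gt0; apply: (kappa_product phi1). Qed.
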